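(* Let $\mathcal{A}$ be an operator algebra. For every $n\in\mathbb{N}$, let $\mathcal{J}_n\subset\mathcal{A}$ be a closed two-sided ideal of $\mathcal{A}$ with a contractive approximate identity $(e^{(n)}_\lambda)_{\lambda\in\Lambda_n}$. Assume that for every $a\in\mathcal{A}$ we have $$\lim_{n\to\infty}\liminf_{\lambda\in\Lambda_n}\|ae^{(n)}_\lambda\|=0\quad\text{and}\quad\lim_{n\to\infty}\liminf_{\lambda\in\Lambda_n}\|e^{(n)}_\lambda a\|=0.$$ Assume also that $\mathcal{A}/\mathcal{J}_n$ is finite-dimensional for every $n\in\mathbb{N}$. Then $C^*_{\max}(\mathcal{A})$ is RFD.
   Context: An operator algebra is a norm closed subalgebra of $B(\mathfrak{H})$, $\mathfrak{H}$ a complex Hilbert space. A contractive approximate identity of an operator algebra $\mathcal{J}$ is a net of contractions $(e_\lambda)_\lambda$ in $\mathcal{J}$ such that $e_\lambda a\to a$ and $ae_\lambda\to a$ in norm for every $a\in\mathcal{J}$. A $C^*$-algebra is residually finite-dimensional (RFD) if it admits an injective $*$-homomorphism into a product $\prod_\lambda\mathbb{M}_{r_\lambda}$ of matrix algebras (bounded families, supremum norm). The maximal $C^*$-cover of $\mathcal{A}$ is the essentially unique pair $(C^*_{\max}(\mathcal{A}),\mu)$ where $C^*_{\max}(\mathcal{A})$ is a $C^*$-algebra and $\mu:\mathcal{A}\to C^*_{\max}(\mathcal{A})$ is a completely isometric homomorphism with $C^*(\mu(\mathcal{A}))=C^*_{\max}(\mathcal{A})$, such that for every completely contractive homomorphism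 $\phi:\mathcal{A}\to B(\mathfrak{H}_\phi)$ there is a $*$-homomorphism $\pi_\phi:C^*_{\max}(\mathcal{A})\to B(\mathfrak{H}_\phi)$ with $\pi_\phi\circ\mu=\phi$. *)

(* Defs.v *)
From HB Require Import structures.
From mathcomp Require Import all_boot all_order all_algebra complex sesquilinear.
From mathcomp Require Import all_classical all_reals.
From mathcomp Require Import ereal topology normedtype sequences.
Import Order.TTheory GRing.Theory Num.Theory numFieldNormedType.Exports.

Set Implicit Arguments.
Unset Strict Implicit.
Unset Printing Implicit Defensive.

Local Open Scope classical_set_scope.
Local Open Scope complex_scope.
Local Open Scope ring_scope.

(* The inner product is linear in its first argument. *)
Record hilbert (R : realType) := Hilbert {
  hcar :> completeNormedModType R[i];
  inner : {dot hcar for @Num.conj R[i]};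
  innerE : forall x : hcar, inner x x = `|x| ^+ 2 }.

(* The library norm of a complex normed space takes its values in R[i];
   nrm is the same norm as a number of R. *)
Definition nrm (R : realType) (V : normedModType R[i]) (x : V) : R :=
  complex.Re `|x|.

Section Nrm.
Variables (R : realType) (V : normedModType R[i]).
Implicit Types x y : V.

Lemma Re_normE (c : R[i]) : (complex.Re `|c|)%:C = `|c|.
Proof. by rewrite RRe_real// ger0_real. Qed.

Lemma Re_norm_ge0 (c : R[i]) : 0 <= complex.Re `|c|.
Proof. by rewrite -lecR Re_normE; exact: normr_ge0. Qed.

Lemma nrmE x : (nrm x)%:C = `|x|.
Proof. by rewrite /nrm RRe_real// ger0_real. Qed.

Lemma nrm_ge0 x : 0 <= nrm x.
Proof. by rewrite -lecR nrmE; exact: normr_ge0. Qed.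

Lemma nrm0 : nrm (0 : V) = 0.
Proof. by rewrite /nrm normr0. Qed.

Lemma nrm_eq0 x : nrm x = 0 -> x = 0.
Proof. by move=> x0; apply/normr0_eq0; rewrite -nrmE x0. Qed.

Lemma ler_nrmD x y : nrm (x + y) <= nrm x + nrm y.
Proof. by rewrite -lecR rmorphD/= !nrmE ler_normD. Qed.

Lemma nrmZ (c : R[i]) x : nrm (c *: x) = complex.Re `|c| * nrm x.
Proof.
apply: complexI; rewrite nrmE normrZ -[`|c|]Re_normE -[`|x|]nrmE.
exact/esym/rmorphM.
Qed.

End Nrm.

Record bop (R : realType) (H : hilbert R) := Bop {
  bop_fun :> H -> H;
  bop_linear : linear bop_fun;
  bop_bounded : exists M : R, forall x, nrm (bop_fun x) <= M * nrm x }.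

HB.instance Definition _ (R : realType) (H : hilbert R) := gen_eqMixin (bop H).
HB.instance Definition _ (R : realType) (H : hilbert R) :=
  gen_choiceMixin (bop H).

Section BopAlgebra.
Variables (R : realType) (H : hilbert R).
Implicit Types S T U : bop H.

Lemma bop_ext S T : (forall x, S x = T x) -> S = T.
Proof.
case: S T => [f lf bf] [g lg bg] /= /funext fg; case: g / fg lg bg => lg bg.
by rewrite (Prop_irrelevance lf lg) (Prop_irrelevance bf bg).
Qed.

Lemma bopD T x y : T (x + y) = T x + T y.
Proof. by rewrite -[x in LHS]scale1r bop_linear scale1r. Qed.

Lemma bop0 T : T 0 = 0.
Proof. by apply: (addrI (T 0)); rewrite -bopD !addr0. Qed.

Lemma bopZ T (c : R[i]) x : T (c *: x) = c *: T x.
Proof. by rewrite -[c *: x]addr0 bop_linear bop0 addr0. Qed.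

Lemma bop_bound T : exists2 M : R, 0 <= M & forall x, nrm (T x) <= M * nrm x.
Proof.
have [M TM] := bop_bounded T; exists `|M| => // x.
by apply: le_trans (TM x) _; rewrite ler_wpM2r ?nrm_ge0// ler_norm.
Qed.

Fact zero_linear : linear (fun _ : H => 0 : H).
Proof. by move=> c x y; rewrite scaler0 addr0. Qed.
Fact zero_bounded :
  exists M : R, forall x : H, nrm ((fun _ => 0 : H) x) <= M * nrm x.
Proof. by exists 0 => x; rewrite nrm0 mul0r. Qed.
Definition bop_zero := Bop zero_linear zero_bounded.

Fact one_linear : linear (fun x : H => x).
Proof. by []. Qed.
Fact one_bounded : exists M : R, forall x : H, nrm x <= M * nrm x.
Proof. by exists 1 => x; rewrite mul1r. Qed.
Definition bop_one := Bop one_linear one_bounded.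

Fact add_linear S T : linear (fun x => S x + T x).
Proof. by move=> c x y; rewrite !bop_linear scalerDr addrACA. Qed.
Fact add_bounded S T :
  exists M : R, forall x : H, nrm (S x + T x) <= M * nrm x.
Proof.
have [M SM] := bop_bounded S; have [N TN] := bop_bounded T.
by exists (M + N) => x; rewrite (le_trans (ler_nrmD _ _))// mulrDl lerD.
Qed.
Definition bop_add S T := Bop (add_linear S T) (add_bounded S T).

Fact scale_linear (c : R[i]) T : linear (fun x => c *: T x).
Proof. by move=> d x y; rewrite bop_linear scalerDr !scalerA mulrC. Qed.
Fact scale_bounded (c : R[i]) T :
  exists M : R, forall x : H, nrm (c *: T x) <= M * nrm x.
Proof.
have [M TM] := bop_bounded T; exists (complex.Re `|c| * M) => x.
by rewrite nrmZ -mulrA ler_wpM2l// Re_norm_ge0.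
Qed.
Definition bop_scale c T := Bop (scale_linear c T) (scale_bounded c T).

Fact comp_linear S T : linear (fun x => S (T x)).
Proof. by move=> c x y; rewrite !bop_linear. Qed.
Fact comp_bounded S T : exists M : R, forall x : H, nrm (S (T x)) <= M * nrm x.
Proof.
have [M M0 SM] := bop_bound S; have [N TN] := bop_bounded T.
by exists (M * N) => x; rewrite (le_trans (SM _))// -mulrA ler_wpM2l.
Qed.
Definition bop_comp S T := Bop (comp_linear S T) (comp_bounded S T).

Fact bop_addA : associative bop_add.
Proof. by move=> S T U; apply: bop_ext => x /=; rewrite addrA. Qed.
Fact bop_addC : commutative bop_add.
Proof. by move=> S T; apply: bop_ext => x /=; rewrite addrC. Qed.
Fact bop_add0 : left_id bop_zero bop_add.
Proof. by move=> S; apply: bop_ext => x /=; rewrite add0r. Qed.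
Fact bop_addN : left_inverse bop_zero (bop_scale (-1)) bop_add.
Proof. by move=> S; apply: bop_ext => x /=; rewrite scaleN1r addNr. Qed.

HB.instance Definition _ := GRing.isZmodule.Build (bop H)
  bop_addA bop_addC bop_add0 bop_addN.

Fact bop_compA : associative bop_comp.
Proof. by move=> S T U; apply: bop_ext. Qed.
Fact bop_comp1l : left_id bop_one bop_comp.
Proof. by move=> S; apply: bop_ext. Qed.
Fact bop_comp1r : right_id bop_one bop_comp.
Proof. by move=> S; apply: bop_ext. Qed.
Fact bop_compDl : left_distributive bop_comp +%R.
Proof. by move=> S T U; apply: bop_ext. Qed.
Fact bop_compDr : right_distributive bop_comp +%R.
Proof. by move=> S T U; apply: bop_ext => x /=; rewrite bopD. Qed.

HB.instance Definition _ := GRing.Zmodule_isPzRing.Build (bop H)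
  bop_compA bop_comp1l bop_comp1r bop_compDl bop_compDr.

Fact bop_scaleA (c d : R[i]) T :
  bop_scale c (bop_scale d T) = bop_scale (c * d) T.
Proof. by apply: bop_ext => x /=; rewrite scalerA. Qed.
Fact bop_scale1 : left_id 1 bop_scale.
Proof. by move=> T; apply: bop_ext => x /=; rewrite scale1r. Qed.
Fact bop_scaleDr : right_distributive bop_scale +%R.
Proof. by move=> c S T; apply: bop_ext => x /=; rewrite scalerDr. Qed.
Fact bop_scaleDl T : {morph bop_scale^~ T : c d / c + d}.
Proof. by move=> c d; apply: bop_ext => x /=; rewrite scalerDl. Qed.

HB.instance Definition _ := GRing.Zmodule_isLmodule.Build R[i] (bop H)
  bop_scaleA bop_scale1 bop_scaleDr bop_scaleDl.

Definition opnorm T : R := sup [set nrm (T x) | x in [set x | nrm x <= 1]].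

Lemma opnorm_has_sup T :
  has_sup [set nrm (T x) | x in [set x | nrm x <= 1]].
Proof.
split; first by exists (nrm (T 0)); exists 0 => //=; rewrite nrm0.
have [M M0 TM] := bop_bound T; exists M => _ [x /= x1 <-].
by rewrite (le_trans (TM x))// ler_piMr.
Qed.

Lemma opnorm_ge0 T : 0 <= opnorm T.
Proof.
apply: sup_upper_bound (opnorm_has_sup T) _ _.
by exists 0; rewrite /= ?nrm0// bop0 nrm0.
Qed.

Lemma nrm_bop_le T x : nrm (T x) <= opnorm T * nrm x.
Proof.
have [->|x0] := eqVneq x 0; first by rewrite bop0 nrm0 mulr0.
have nx0 : 0 < nrm x.
  by rewrite lt_def nrm_ge0 andbT; apply: contra_neq x0 => /nrm_eq0.
have nV : complex.Re `|((nrm x)^-1)%:C| = (nrm x)^-1.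
  by rewrite ger0_norm// lecR invr_ge0 nrm_ge0.
rewrite -ler_pdivrMr// mulrC -{1}nV -nrmZ -bopZ.
apply: sup_upper_bound (opnorm_has_sup T) _ _.
exists (((nrm x)^-1)%:C *: x) => //=.
by rewrite nrmZ nV mulVf// gt_eqF.
Qed.

Lemma opnorm_le T (M : R) :
  0 <= M -> (forall x, nrm (T x) <= M * nrm x) -> opnorm T <= M.
Proof.
move=> M0 TM; apply: ge_sup; first by case: (opnorm_has_sup T).
by move=> _ [x /= x1 <-]; rewrite (le_trans (TM x))// ler_piMr.
Qed.

Fact bop_normD S T : (opnorm (S + T))%:C <= (opnorm S)%:C + (opnorm T)%:C.
Proof.
rewrite -rmorphD lecR opnorm_le ?addr_ge0 ?opnorm_ge0// => x.
by rewrite (le_trans (ler_nrmD _ _))// mulrDl lerD ?nrm_bop_le.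
Qed.

Fact bop_normZ (c : R[i]) T : (opnorm (c *: T))%:C = `|c| * (opnorm T)%:C.
Proof.
have le_normZ (d : R[i]) S : (opnorm (d *: S))%:C <= `|d| * (opnorm S)%:C.
  rewrite -[`|d|]Re_normE -rmorphM lecR.
  apply: opnorm_le => [|x]; first by rewrite mulr_ge0 ?Re_norm_ge0 ?opnorm_ge0.
  by rewrite nrmZ -mulrA ler_wpM2l ?Re_norm_ge0 ?nrm_bop_le.
apply/le_anti; rewrite le_normZ/=.
have [->|c0] := eqVneq c 0; first by rewrite normr0 mul0r lecR opnorm_ge0.
have := le_normZ c^-1 (c *: T).
by rewrite scalerA mulVf// scale1r normfV ler_pdivlMl// normr_gt0.
Qed.

Fact bop_norm_eq0 T : (opnorm T)%:C = 0 -> T = 0.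
Proof.
move=> /complexI T0; apply: bop_ext => x; apply: nrm_eq0; apply/le_anti.
by rewrite nrm_ge0 andbT (le_trans (nrm_bop_le T x))// T0 mul0r.
Qed.

HB.instance Definition _ := Lmodule_isNormed.Build R[i] (bop H)
  bop_normD bop_normZ bop_norm_eq0.

Lemma bop_normE T : `|T| = (opnorm T)%:C.
Proof. by []. Qed.

End BopAlgebra.

Section OperatorAlgebra.
Variables (R : realType) (H : hilbert R).
Implicit Types (A B J S : set (bop H)) (a b c : bop H).

Definition subalgebra A :=
  [/\ A 0,
      forall (z : R[i]) a b, A a -> A b -> A (z *: a + b)
    & forall a b, A a -> A b -> A (a * b)].

Definition operator_algebra A := closed A /\ subalgebra A.

Definition closed_ideal A J :=
  [/\ J `<=` A, closed J, J 0,
      forall (z : R[i]) a b, J a -> J b -> J (z *: a + b)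
    & forall a b, A a -> J b -> J (a * b) /\ J (b * a)].

(* The vector space A / J is spanned by the classes of finitely many b_i. *)
Definition finite_dim_quotient A J :=
  exists d : nat, exists2 b : 'I_d -> bop H, (forall k, A (b k)) &
    forall a, A a -> exists z : 'I_d -> R[i], J (a - \sum_k z k *: b k).

(* b = a^*; the adjoint exists and is unique by the Riesz representation
   theorem, so that conditions on a^* can be stated through this relation. *)
Definition adjoint a b := forall x y : H, inner H (a x) y = inner H x (b y).

(* C*-algebras are taken concretely, as self-adjoint operator algebras; matrices
   over them then have the norm of the operators on a power of the Hilbert
   space. *)
Definition cstar_algebra B :=
  operator_algebra B /\ forall b, B b -> exists2 c, B c & adjoint b c.

Definition cstar_gen S :=
  \bigcap_(B in [set B | cstar_algebra B /\ S `<=` B]) B.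

End OperatorAlgebra.

Record directedSet := DirectedSet {
  dcar :> Type;
  dle : dcar -> dcar -> Prop;
  dle_refl : forall l, dle l l;
  dle_trans : forall l m n, dle l m -> dle m n -> dle l n;
  dle_directed : forall l m, exists2 n, dle l n & dle m n;
  dcar_inhabited : inhabited dcar }.

Definition tails (L : directedSet) : set_system L :=
  [set V | exists l0, forall l, dle l0 l -> V l].
Arguments tails : clear implicits.

Definition net_liminf (R : realType) (L : directedSet) (u : L -> \bar R) :=
  ereal_sup [set ereal_inf [set u l | l in [set l | dle l0 l]] | l0 in setT].

Definition contractive_approx_id (R : realType) (H : hilbert R)
    (J : set (bop H)) (L : directedSet) (e : L -> bop H) :=
  [/\ forall l, J (e l),
      forall l, opnorm (e l) <= 1
    & forall a, J a -> ((fun l => e l * a) @ tails L --> a) /\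
                       ((fun l => a * e l) @ tails L --> a)].

Definition l2norm (R : realType) (V : normedModType R[i]) n
    (x : 'I_n -> V) : R :=
  Num.sqrt (\sum_k nrm (x k) ^+ 2).

(* The norm of a matrix over B(H), seen as an operator on H^n. *)
Definition mx_opnorm (R : realType) (H : hilbert R) n (a : 'M[bop H]_n) : R :=
  sup [set l2norm (fun j => \sum_k a j k (x k)) |
       x in [set x : 'I_n -> H | l2norm x <= 1]].

(* A map defined on A is represented by a map on B(H), whose values outside of A
   are irrelevant. *)
Section Morphisms.
Variables (R : realType) (H K : hilbert R) (A : set (bop H)).
Implicit Types phi : bop H -> bop K.

Definition alg_hom phi :=
  (forall (z : R[i]) a b, A a -> A b ->
     phi (z *: a + b) = z *: phi a + phi b) /\
  (forall a b, A a -> A b -> phi (a * b) = phi a * phi b).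

Definition star_hom phi :=
  alg_hom phi /\
  (forall a b, A a -> A b -> adjoint a b -> adjoint (phi a) (phi b)).

Definition completely_contractive phi :=
  forall n (a : 'M[bop H]_n), (forall j k, A (a j k)) ->
    mx_opnorm (map_mx phi a) <= mx_opnorm a.

Definition completely_isometric phi :=
  forall n (a : 'M[bop H]_n), (forall j k, A (a j k)) ->
    mx_opnorm (map_mx phi a) = mx_opnorm a.

End Morphisms.

Record max_cstar_cover (R : realType) (H : hilbert R) (A : set (bop H))
    (K : hilbert R) (B : set (bop K)) (mu : bop H -> bop K) : Prop := {
  mcc_cstar : cstar_algebra B;
  mcc_hom : alg_hom A mu;
  mcc_isometric : completely_isometric A mu;
  mcc_gen : cstar_gen (mu @` A) = B;
  mcc_universal : forall (L : hilbert R) (phi : bop H -> bop L),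
    alg_hom A phi -> completely_contractive A phi ->
    exists2 pi : bop K -> bop L,
      star_hom B pi & forall a, A a -> pi (mu a) = phi a }.

(* The norm of the C*-algebra of r x r matrices. The library norm on matrices is
   the maximum of the entries. *)
Definition mx2norm (R : realType) r (a : 'M[R[i]]_r) : R :=
  sup [set l2norm (fun k => (a *m v) k 0 : R[i]^o) |
       v in [set v : 'cV[R[i]]_r | l2norm (fun k => v k 0 : R[i]^o) <= 1]].

(* An injective *-homomorphism pi from B to a product of matrix algebras; the
   operations of the product are componentwise. *)
Definition RFD (R : realType) (K : hilbert R) (B : set (bop K)) :=
  exists (I : Type) (r : I -> nat) (pi : bop K -> forall l, 'M[R[i]]_((r l).+1)),
  [/\ forall b, B b -> exists M : R, forall l, mx2norm (pi b l) <= M,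
      forall (z : R[i]) b c l,
        B b -> B c -> pi (z *: b + c) l = z *: pi b l + pi c l,
      forall b c l, B b -> B c -> pi (b * c) l = pi b l *m pi c l,
      forall b c l, B b -> B c -> adjoint b c ->
        pi c l = map_mx (@Num.conj R[i]) (pi b l)^T
    & forall b c, B b -> B c -> (forall l, pi b l = pi c l) -> b = c].

(* Main.v *)
Require Import Defs.
From mathcomp Require Import all_boot all_order all_algebra complex sesquilinear.
From mathcomp Require Import all_classical all_reals.
From mathcomp Require Import ereal topology normedtype sequences.
From mathcomp Require Import ring lra.
Import Order.TTheory GRing.Theory Num.Theory numFieldNormedType.Exports.

Set Implicit Arguments.
Unset Strict Implicit.
Unset Printing Implicit Defensive.

Local Open Scope classical_set_scope.
Local Open Scope complex_scope.
Local Open Scope ring_scope.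

(* mu embeds A in B(K). For each n, the vectors fixed in the limit by
   mu(e^(n)_lambda) form the closure of mu(J_n)K; let p_n be the projection onto it.
   A contraction almost fixing a vector has an adjoint almost fixing it, so mu(J_n)
   vanishes on the range of 1 - p_n, and |mu(a) p_n| <= liminf |a e^(n)_lambda|.
   Hence mu(A) acts on (1 - p_n)K through the finite-dimensional A/J_n, and any
   finite set of vectors there lies in a finite-dimensional mu(A)-invariant subspace
   F, with projection P. The map a |-> mu(a) P is a completely contractive
   homomorphism, so the universal property extends it to a *-homomorphism of B, which
   lives on F. As n and F grow, mu(a) P tends to mu(a) and P mu(a)^* tends to
   mu(a)^* strongly; since *-homomorphisms are contractive, the same convergence
   holds on all of B, so these representations separate its points. *)

(** * Normed spaces, inner products and projections *)

Section NormedSpace.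
Variables (R : realType) (V : normedModType R[i]).
Implicit Types (x y : V) (S : set V).

Lemma nrmN x : nrm (- x) = nrm x.
Proof. by rewrite /nrm normrN. Qed.

Lemma nrmB x y : nrm (x - y) = nrm (y - x).
Proof. by rewrite -nrmN opprB. Qed.

Lemma ler_nrm_dist x y z : nrm (x - z) <= nrm (x - y) + nrm (y - z).
Proof. by have := ler_nrmD (x - y) (y - z); rewrite addrA subrK. Qed.

(** The balls of the topology have radii in [R[i]]. A positive radius is real, so real radii
    suffice, and halving it turns [<=] into the strict inequality of a ball. *)
Lemma closed_nrmP S x : closed S ->
  (forall e : R, 0 < e -> exists2 y, S y & nrm (x - y) <= e) -> S x.
Proof.
move=> Scl Sx; apply: Scl => U /nbhs_normP[e /= e0 eU].
have eR : (complex.Re e)%:C = e by rewrite RRe_real// ger0_real// ltW.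
have e20 : 0 < complex.Re e / 2 by rewrite divr_gt0// -ltcR eR.
have [y Sy xy] := Sx _ e20; exists y; split=> //; apply: eU => /=.
rewrite -nrmE -eR ltcR (le_lt_trans xy)// ltr_pdivrMr//.
by rewrite mulr_natr mulr2n ltrDl -ltcR eR.
Qed.

Lemma nrm_closed S :
  (forall x, (forall e : R, 0 < e -> exists2 y, S y & nrm (x - y) <= e) -> S x) ->
  closed S.
Proof.
move=> HS x xS; apply: HS => e e0.
have [] := xS [set y | nrm (x - y) < e].
  apply/nbhs_normP; exists e%:C => /=; first by rewrite ltcR.
  by move=> y /=; rewrite -nrmE ltcR.
by move=> y [Sy /= /ltW xy]; exists y.
Qed.

End NormedSpace.

Lemma inv_succ_le (R : realType) (e : R) : 0 < e ->
  exists N, forall n, (N <= n)%N -> n.+1%:R^-1 <= e.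
Proof.
move=> e0; exists (Num.bound e^-1) => n Nn.
rewrite invf_ple ?posrE ?ltr0n//.
have /archi_boundP/ltW/le_trans : 0 <= e^-1 by rewrite invr_ge0 ltW.
by apply; rewrite ler_nat (leq_trans Nn).
Qed.

Lemma nrm_cauchy (R : realType) (V : completeNormedModType R[i]) (u : nat -> V) :
  (forall e : R, 0 < e -> exists N, forall m n, (N <= m)%N -> (N <= n)%N ->
     nrm (u m - u n) <= e) ->
  exists l, forall e : R, 0 < e -> exists N, forall n, (N <= n)%N ->
     nrm (l - u n) <= e.
Proof.
move=> uC.
have : cvg (u @ \oo).
  apply/cauchy_cvgP/cauchy_exP => e e0.
  have eR : (complex.Re e)%:C = e by rewrite RRe_real// ger0_real// ltW.
  have e20 : 0 < complex.Re e / 2 by rewrite divr_gt0// -ltcR eR.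
  have [N uN] := uC _ e20; exists (u N); exists N => // n /= Nn.
  rewrite -ball_normE /= -nrmE -eR ltcR (le_lt_trans (uN _ _ _ _))//.
  by rewrite ltr_pdivrMr// mulr_natr mulr2n ltrDl -ltcR eR.
move=> /cvg_ex[l ul]; exists l => e e0.
have /= := ul [set y | nrm (l - y) < e].
case.
  apply/nbhs_normP; exists e%:C => /=; first by rewrite ltcR.
  by move=> y /=; rewrite -nrmE ltcR.
by move=> N _ NE; exists N => n Nn; apply/ltW/NE.
Qed.

Section InnerProduct.
Variables (R : realType) (H : hilbert R).
Implicit Types x y z : H.

Lemma innerC x y : inner H x y = (inner H y x)^*%C.
Proof. by rewrite (hermC (inner H) x y) expr0 mul1r. Qed.

Lemma innerDl x y z : inner H (x + y) z = inner H x z + inner H y z.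
Proof. exact: linearDl. Qed.
Lemma innerDr x y z : inner H z (x + y) = inner H z x + inner H z y.
Proof. exact: linearDr. Qed.
Lemma innerZl (c : R[i]) x y : inner H (c *: x) y = c * inner H x y.
Proof. exact: linearZl_LR. Qed.
Lemma innerZr (c : R[i]) x y : inner H x (c *: y) = c^*%C * inner H x y.
Proof. exact: linearZr_LR. Qed.
Lemma inner0l x : inner H 0 x = 0. Proof. exact: linear0l. Qed.
Lemma inner0r x : inner H x 0 = 0. Proof. exact: linear0r. Qed.
Lemma innerNl x y : inner H (- x) y = - inner H x y.
Proof. exact: linearNl. Qed.
Lemma inner_suml I (r : seq I) (P : pred I) (F : I -> H) y :
  inner H (\sum_(i <- r | P i) F i) y = \sum_(i <- r | P i) inner H (F i) y.
Proof. exact: linear_sumlz. Qed.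
Lemma inner_sumr I (r : seq I) (P : pred I) (F : I -> H) y :
  inner H y (\sum_(i <- r | P i) F i) = \sum_(i <- r | P i) inner H y (F i).
Proof. exact: linear_sumr. Qed.

Definition rinner x y : R := complex.Re (inner H x y).

Lemma rinnerC x y : rinner x y = rinner y x.
Proof. by rewrite /rinner innerC; case: (inner H y x). Qed.

Lemma rinnerDl x y z : rinner (x + y) z = rinner x z + rinner y z.
Proof. by rewrite /rinner innerDl raddfD. Qed.

Lemma rinnerDr x y z : rinner z (x + y) = rinner z x + rinner z y.
Proof. by rewrite !(rinnerC z) rinnerDl. Qed.

Lemma rinnerNl x y : rinner (- x) y = - rinner x y.
Proof. by rewrite /rinner innerNl raddfN. Qed.

Lemma rinnerNr x y : rinner y (- x) = - rinner y x.
Proof. by rewrite !(rinnerC y) rinnerNl. Qed.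

Lemma rinnerZl (t : R) x y : rinner (t%:C *: x) y = t * rinner x y.
Proof.
by rewrite /rinner innerZl /=; case: (inner H x y) => a b /=; rewrite mul0r subr0.
Qed.

Lemma rinnerZr (t : R) x y : rinner y (t%:C *: x) = t * rinner y x.
Proof. by rewrite !(rinnerC y) rinnerZl. Qed.

Lemma rinnerxx x : rinner x x = nrm x ^+ 2.
Proof. by rewrite /rinner innerE -nrmE -rmorphXn. Qed.

Lemma nrm_sqrD x y : nrm (x + y) ^+ 2 = nrm x ^+ 2 + 2 * rinner x y + nrm y ^+ 2.
Proof.
rewrite -!rinnerxx rinnerDl !rinnerDr (rinnerC y x); ring.
Qed.

Lemma nrm_sqrB x y : nrm (x - y) ^+ 2 = nrm x ^+ 2 - 2 * rinner x y + nrm y ^+ 2.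
Proof. by rewrite nrm_sqrD rinnerNr nrmN; ring. Qed.

(** The triangle inequality comes with the normed space, so Cauchy-Schwarz is obtained by squaring
    it, in the reverse of the usual order. *)
Lemma rinner_le x y : rinner x y <= nrm x * nrm y.
Proof.
have := ler_nrmD x y; rewrite -(@ler_pXn2r _ 2) ?nnegrE ?addr_ge0 ?nrm_ge0//.
by rewrite nrm_sqrD sqrrD; lra.
Qed.

Lemma inner_eq0 x y : (forall c : R[i], rinner x (c *: y) = 0) -> inner H x y = 0.
Proof.
move=> h; have := h 1; have := h 'i.
rewrite !(rinnerC x) /rinner !innerZl /= mul1r innerC.
by case: (inner H x y) => a b /=; simpc => /eqP; rewrite ?oppr_eq0 => /eqP -> ->.
Qed.

(** Used to cancel one factor after Cauchy-Schwarz has bounded a squared norm; the case of norm zero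
    needs [0 <= M]. *)
Lemma nrm_rinner_le x (M : R) : 0 <= M -> (nrm x ^+ 2 <= M * nrm x) -> nrm x <= M.
Proof.
move=> M0; have [->//|x0] := eqVneq (nrm x) 0.
by rewrite expr2 ler_pM2r// lt_def x0 nrm_ge0.
Qed.

End InnerProduct.

Definition lin_subspace (R : realType) (V : normedModType R[i]) (N : set V) :=
  N 0 /\ forall (c : R[i]) x y, N x -> N y -> N (c *: x + y).

Section Projection.
Variables (R : realType) (H : hilbert R) (N : set H).
Hypotheses (N_sub : lin_subspace N) (N_closed : closed N).

Lemma lin_subspaceZ (c : R[i]) x : N x -> N (c *: x).
Proof. by case: N_sub => N0 ND Nx; rewrite -[_ *: _]addr0; exact: ND. Qed.

Lemma lin_subspaceD x y : N x -> N y -> N (x + y).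
Proof. by case: N_sub => _ ND Nx Ny; rewrite -[x]scale1r; exact: ND. Qed.

Lemma lin_subspaceB x y : N x -> N y -> N (x - y).
Proof.
by move=> Nx Ny; apply: lin_subspaceD => //; rewrite -scaleN1r; exact: lin_subspaceZ.
Qed.

(** A minimizing sequence is Cauchy by the parallelogram law, and its limit stays in the closed
    subspace [N]. *)
Lemma nearest_point x : exists2 u, N u & forall y, N y -> nrm (x - u) <= nrm (x - y).
Proof.
pose D := [set nrm (x - y) | y in N].
have N0 : N 0 by case: N_sub.
have Dinf : has_inf D.
  split; first by exists (nrm (x - 0)); exists 0.
  by exists 0 => _ [y _ <-]; exact: nrm_ge0.
pose d := inf D.
have dle y : N y -> d <= nrm (x - y).
  by move=> Ny; apply: ge_inf; [case: Dinf|exists y].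
have d0 : 0 <= d.
  by apply: lb_le_inf; [case: Dinf|move=> _ [y _ <-]; exact: nrm_ge0].
have /choice[u uP] (n : nat) : exists y, N y /\ nrm (x - y) ^+ 2 <= d ^+ 2 + n.+1%:R^-1.
  have e0 : 0 < (n.+1%:R^-1 : R) by rewrite invr_gt0 ltr0n.
  have dd : d < Num.sqrt (d ^+ 2 + n.+1%:R^-1).
    rewrite -[ltLHS]ger0_norm// -sqrtr_sqr ltr_sqrt ?ltrDl//.
    by rewrite ltr_wpDl ?sqr_ge0.
  have [_ [y Ny <-]] := @inf_adherent _ D (Num.sqrt (d ^+ 2 + n.+1%:R^-1) - d)
    (etrans (subr_gt0 _ _) dd) Dinf.
  rewrite -/d [d + _]addrC subrK => yd; exists y; split=> //.
  have := yd; rewrite -(@ltr_pXn2r _ 2) ?nnegrE ?nrm_ge0 ?sqrtr_ge0// sqr_sqrtr.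
    by move/ltW.
  by rewrite addr_ge0 ?sqr_ge0// ltW.
have uC m n : nrm (u m - u n) ^+ 2 <= 2 * m.+1%:R^-1 + 2 * n.+1%:R^-1.
  have [Nm um] := uP m; have [Nn un] := uP n.
  set p := x - u m in um; set q := x - u n in un.
  (* The midpoint of [u m] and [u n] lies in [N], so [p + q] has norm at least [2 * d]; the
     parallelogram law then leaves little room for [q - p]. *)
  have pq : p + q = 2%:C *: (x - (2^-1)%:C *: (u m + u n)).
    rewrite scalerBr scalerA -rmorphM /= divff// scale1r /p /q.
    by rewrite -[2]/(1 + 1) rmorphD scalerDl scale1r opprD addrACA.
  have /dle mid : N ((2^-1)%:C *: (u m + u n)).
    by apply: lin_subspaceZ; exact: lin_subspaceD.
  have pq4 : 4 * d ^+ 2 <= nrm (p + q) ^+ 2.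
    rewrite pq nrmZ normc_def /= expr0n addr0 sqrtr_sqr ger0_norm// exprMn.
    by rewrite -natrX ler_pM2l// ler_pXn2r ?nnegrE ?nrm_ge0.
  have -> : u m - u n = q - p by rewrite /p /q opprB [RHS]addrC addrA subrK.
  move: um un pq4; rewrite (nrm_sqrB q p) (nrm_sqrD p q) (rinnerC q).
  move: (m.+1%:R^-1 : R) (n.+1%:R^-1 : R) => a b; lra.
have [|v vP] := @nrm_cauchy _ _ u.
  move=> e e0; have e40 : 0 < e ^+ 2 / 4 by rewrite divr_gt0 ?exprn_gt0.
  have [M MP] := inv_succ_le e40; exists M => m n /MP Mm /MP Mn.
  rewrite -(@ler_pXn2r _ 2) ?nnegrE ?nrm_ge0 ?(ltW e0)//.
  by move: (uC m n) Mm Mn; move: (m.+1%:R^-1 : R) (n.+1%:R^-1 : R) => a b; lra.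
exists v.
  apply: (closed_nrmP N_closed) => e e0; have [M MP] := vP e e0.
  by exists (u M); [case: (uP M)|exact: MP].
move=> y /dle; apply: le_trans; apply/ler_addgt0Pr => e e0.
have e20 : 0 < e / 2 by rewrite divr_gt0.
have [M MP] := vP _ e20.
have e220 : 0 < (e / 2) ^+ 2 by rewrite exprn_gt0.
have [K KP] := inv_succ_le e220.
pose n := maxn M K.
have {MP} := MP n (leq_maxl _ _); have {KP} := KP n (leq_maxr _ _).
have [_ un] := uP n => Kn Mn.
have dn : nrm (x - u n) <= d + e / 2.
  rewrite -(@ler_pXn2r _ 2) ?nnegrE ?nrm_ge0 ?addr_ge0 ?(ltW e20)//.
  rewrite (le_trans un)// sqrrD.
  by have := mulr_ge0 d0 (ltW e20); move: Kn; move: (n.+1%:R^-1 : R) => a; lra.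
have := ler_nrm_dist x (u n) v; rewrite (nrmB (u n)); lra.
Qed.

Lemma orthogonal_projection x :
  exists2 u, N u & forall y, N y -> inner H (x - u) y = 0.
Proof.
have [u Nu umin] := nearest_point x; exists u => // y Ny.
apply: inner_eq0 => c; set z := c *: y; set w := x - u.
have Nz : N z by exact: lin_subspaceZ.
set r := rinner w z; set s := nrm z ^+ 2.
have tr (t : R) : 2 * t * r <= t ^+ 2 * s.
  have := umin (u + t%:C *: z) (lin_subspaceD Nu (lin_subspaceZ _ Nz)).
  rewrite -(@ler_pXn2r _ 2) ?nnegrE ?nrm_ge0// opprD addrA -/w (nrm_sqrB w).
  rewrite rinnerZr nrmZ normc_def /= expr0n addr0 sqrtr_sqr exprMn real_normK ?num_real//.
  rewrite -/r -/s; lra.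
have s0 : 0 <= s by exact: sqr_ge0.
(* The natural choice [t = r / s] fails for [z = 0]; with [s + 1] the inequality becomes
   [r ^+ 2 * (s + 2) <= 0], which still forces [r = 0]. *)
have := tr (r / (s + 1)) => h.
have s10 : 0 < s + 1 by lra.
have {}h : 2 * r ^+ 2 * (s + 1) <= r ^+ 2 * s.
  rewrite -ler_pdivlMr// -(@ler_pM2r _ (s + 1)^-1) ?invr_gt0//.
  move: h; congr (_ <= _); field; lra.
apply/eqP; rewrite -sqrf_eq0 eq_le sqr_ge0 andbT.
have := mulr_ge0 (sqr_ge0 r) s0; lra.
Qed.

End Projection.

(** * Algebras of bounded operators *)

Lemma le0_of_le_eps (R : realType) (r M : R) :
  (forall e : R, 0 < e -> r <= e * M) -> r <= 0.
Proof.
move=> rM; apply/ler_addgt0Pr => e e0; rewrite add0r.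
have M1 : 0 < `|M| + 1 by rewrite ltr_wpDl.
apply: le_trans (rM (e / (`|M| + 1)) (divr_gt0 e0 M1)) _.
by rewrite mulrAC ler_pdivrMr// ler_pM2l// (le_trans (ler_norm M))// lerDl.
Qed.

Lemma nrm_le_eps_eq0 (R : realType) (V : normedModType R[i]) (x : V) (M : R) :
  (forall e : R, 0 < e -> nrm x <= e * M) -> x = 0.
Proof.
move=> /le0_of_le_eps x0; apply: nrm_eq0; apply/le_anti.
by rewrite x0 nrm_ge0.
Qed.

Section OperatorNorm.
Variables (R : realType) (H : hilbert R).
Implicit Types a b c S T : bop H.

Lemma nrm_bopE T : nrm T = opnorm T. Proof. by []. Qed.

Lemma bopDE S T x : (S + T) x = S x + T x. Proof. by []. Qed.
Lemma bopNE T x : (- T) x = - T x. Proof. exact: scaleN1r. Qed.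
Lemma bopBE S T x : (S - T) x = S x - T x. Proof. by rewrite bopDE bopNE. Qed.
Lemma bopZE (z : R[i]) T x : (z *: T) x = z *: T x. Proof. by []. Qed.
Lemma bopME S T x : (S * T) x = S (T x). Proof. by []. Qed.
Lemma bop0E x : (0 : bop H) x = 0. Proof. by []. Qed.

Lemma bopB T x y : T (x - y) = T x - T y.
Proof. by rewrite bopD -scaleN1r bopZ scaleN1r. Qed.

Lemma bop_sum T I (r : seq I) (P : pred I) (F : I -> H) :
  T (\sum_(i <- r | P i) F i) = \sum_(i <- r | P i) T (F i).
Proof. by apply: (big_morph T (bopD T) (bop0 T)). Qed.

Lemma bop_sumE I (r : seq I) (P : pred I) (F : I -> bop H) x :
  (\sum_(i <- r | P i) F i) x = \sum_(i <- r | P i) F i x.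
Proof. by apply: (big_morph (fun T : bop H => T x)). Qed.

Lemma opnormM S T : opnorm (S * T) <= opnorm S * opnorm T.
Proof.
apply: opnorm_le => [|x]; first by rewrite mulr_ge0 ?opnorm_ge0.
rewrite bopME (le_trans (nrm_bop_le _ _))// -mulrA.
by rewrite ler_wpM2l ?opnorm_ge0// nrm_bop_le.
Qed.

Lemma adjoint_sym a b : adjoint a b -> adjoint b a.
Proof. by move=> ab x y; rewrite innerC -ab -innerC. Qed.

Lemma adjoint_uniq a b c : adjoint a b -> adjoint a c -> b = c.
Proof.
move=> ab ac; apply: bop_ext => y; apply/eqP; rewrite -subr_eq0; apply/eqP.
apply: nrm_eq0; apply/eqP; rewrite -sqrf_eq0 -rinnerxx rinnerDr rinnerNr.
by rewrite /rinner -ab -ac subrr.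
Qed.

Lemma adjointP (z : R[i]) a b a' b' : adjoint a a' -> adjoint b b' ->
  adjoint (z *: a + b) (z^*%C *: a' + b').
Proof.
move=> aa bb x y.
rewrite !bopDE !bopZE innerDl innerDr innerZl innerZr /= aa bb.
congr (_ * _ + _); exact: esym (conjcK z).
Qed.

Lemma adjointM a b a' b' : adjoint a a' -> adjoint b b' ->
  adjoint (a * b) (b' * a').
Proof. by move=> aa bb x y; rewrite !bopME aa bb. Qed.

Lemma adjoint0 : adjoint (0 : bop H) 0.
Proof. by move=> x y; rewrite !bop0E inner0l inner0r. Qed.

Lemma opnorm_adjoint a b : adjoint a b -> opnorm b <= opnorm a.
Proof.
move=> ab; apply: opnorm_le => [|x]; first exact: opnorm_ge0.
apply: nrm_rinner_le; first by rewrite mulr_ge0 ?opnorm_ge0 ?nrm_ge0.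
rewrite -rinnerxx /rinner -ab (le_trans (rinner_le _ _))//.
by rewrite mulrAC ler_wpM2r ?nrm_ge0// nrm_bop_le.
Qed.

(** Pointwise limits exist because [H] is complete. The Cauchy estimate is uniform on bounded sets,
    so it survives the limit and gives linearity, boundedness and norm convergence. *)
Lemma bop_cauchy (s : nat -> bop H) :
  (forall e : R, 0 < e -> exists N, forall m n, (N <= m)%N -> (N <= n)%N ->
     opnorm (s m - s n) <= e) ->
  exists T, forall e : R, 0 < e -> exists N, forall n, (N <= n)%N ->
     opnorm (T - s n) <= e.
Proof.
move=> sC.
have /choice[f fP] (x : H) : exists l, forall e : R, 0 < e ->
    exists N, forall n, (N <= n)%N -> nrm (l - s n x) <= e.
  apply: nrm_cauchy => e e0.
  have x1 : 0 < nrm x + 1 by rewrite ltr_wpDl ?nrm_ge0.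
  have [N NP] := sC _ (divr_gt0 e0 x1); exists N => m n Nm Nn.
  rewrite -bopBE (le_trans (nrm_bop_le _ _))//.
  apply: le_trans (ler_wpM2r (nrm_ge0 _) (NP _ _ Nm Nn)) _.
  by rewrite mulrAC ler_pdivrMr// ler_pM2l// lerDl.
have fs (e : R) : 0 < e -> exists N, forall n x, (N <= n)%N ->
    nrm (f x - s n x) <= e * nrm x.
  move=> e0; have [N NP] := sC e e0; exists N => n x Nn.
  apply/ler_addgt0Pr => d d0; have [M MP] := fP x d d0.
  apply: le_trans (ler_nrm_dist _ (s (maxn N M) x) _) _.
  rewrite addrC lerD ?MP ?leq_maxr// -bopBE (le_trans (nrm_bop_le _ _))//.
  by rewrite ler_wpM2r ?nrm_ge0// NP// leq_maxl.
have flin : linear f.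
  move=> z x y; apply/eqP; rewrite -subr_eq0; apply/eqP.
  apply: (@nrm_le_eps_eq0 _ _ _
    (nrm (z *: x + y) + complex.Re `|z| * nrm x + nrm y)) => e e0.
  have [N NP] := fs e e0; set T := s N.
  have -> : f (z *: x + y) - (z *: f x + f y) =
    (f (z *: x + y) - T (z *: x + y)) - z *: (f x - T x) - (f y - T y).
    rewrite bopD bopZ scalerBr -[RHS]addrA -[- _ - (_ - T y)]opprD.
    by rewrite [_ - _ + (_ - _)]addrACA -[- (z *: T x) - _]opprD opprB addrA subrK.
  rewrite (le_trans (ler_nrm_dist _ 0 _))// subr0 sub0r nrmN mulrDr.
  rewrite lerD ?NP// (le_trans (ler_nrm_dist _ 0 _))// subr0 sub0r nrmN mulrDr.
  by rewrite lerD ?NP// nrmZ mulrCA ler_wpM2l ?Re_norm_ge0 ?NP.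
have fb : exists M : R, forall x, nrm (f x) <= M * nrm x.
  have [N NP] := fs 1 ltr01; exists (1 + opnorm (s N)) => x.
  rewrite mulrDl -[f x](subrK (s N x)) (le_trans (ler_nrmD _ _))// lerD ?NP//.
  exact: nrm_bop_le.
exists (Bop flin fb) => e e0; have [N NP] := fs e e0; exists N => n Nn.
by apply: opnorm_le => [|x]; [exact: ltW|rewrite bopBE /= NP].
Qed.

End OperatorNorm.

Lemma geometric_small (R : realType) (q C e : R) : 0 <= q < 1 -> 0 < e ->
  exists N, forall n, (N <= n)%N -> q ^+ n * C <= e.
Proof.
move=> /andP[q0 q1] e0; have C1 : 0 < `|C| + 1 by rewrite ltr_wpDl.
have /cvgrPdist_le/(_ (e / (`|C| + 1)) (divr_gt0 e0 C1))[N _ NP] :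
    (fun n => q ^+ n : R^o) @ \oo --> (0 : R^o).
  by apply: cvg_expr; rewrite ger0_norm.
exists N => n /NP /=; rewrite sub0r normrN ger0_norm ?exprn_ge0// => qn.
apply: le_trans (_ : q ^+ n * (`|C| + 1) <= _).
  by rewrite ler_wpM2l ?exprn_ge0// (le_trans (ler_norm C))// lerDl.
by rewrite -ler_pdivlMr.
Qed.

Section Algebras.
Variables (R : realType) (H : hilbert R) (A : set (bop H)).
Hypothesis A_alg : operator_algebra A.
Implicit Types (a b c h : bop H).

Lemma opalg0 : A 0. Proof. by case: A_alg => _ []. Qed.
Lemma opalgP (z : R[i]) a b : A a -> A b -> A (z *: a + b).
Proof. move=> Aa Ab; have [_ [_ AP _]] := A_alg; exact: AP. Qed.
Lemma opalgM a b : A a -> A b -> A (a * b).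
Proof. move=> Aa Ab; have [_ [_ _ AM]] := A_alg; exact: AM. Qed.
Lemma opalgD a b : A a -> A b -> A (a + b).
Proof. by move=> Aa Ab; rewrite -[a]scale1r; exact: opalgP. Qed.
Lemma opalgZ (z : R[i]) a : A a -> A (z *: a).
Proof. by move=> Aa; rewrite -[_ *: _]addr0; exact: opalgP opalg0. Qed.
Lemma opalgB a b : A a -> A b -> A (a - b).
Proof. by move=> Aa Ab; rewrite -scaleN1r; apply: opalgD => //; exact: opalgZ. Qed.
Lemma opalg_sum I (r : seq I) (F : I -> bop H) :
  (forall i, A (F i)) -> A (\sum_(i <- r) F i).
Proof.
by move=> AF; elim/big_ind: _ => [|a b|i _]; [exact: opalg0|exact: opalgD|exact: AF].
Qed.

(** The equation says that [1 + c] is a left inverse of [1 - h]; it avoids the unit, which [A] need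
    not contain. The [s n] are the partial sums of the powers of [h] from the first on. *)
Lemma neumann_series h : A h -> opnorm h < 1 -> exists2 c, A c & c = h + c * h.
Proof.
move=> Ah h1; pose s := fix s n := if n is n.+1 then h + s n * h else 0.
pose q := opnorm h; have q0 : 0 <= q by exact: opnorm_ge0.
have q1 : 0 < 1 - q by rewrite subr_gt0.
have As n : A (s n).
  by elim: n => [|n IH] /=; [exact: opalg0|apply/opalgD/opalgM].
have s_bound n : opnorm (s n) <= (1 - q)^-1.
  elim: n => [|n IH] /=; first by rewrite -nrm_bopE nrm0 invr_ge0 ltW.
  rewrite -nrm_bopE (le_trans (ler_nrmD _ _))// !nrm_bopE.
  rewrite (le_trans (lerD (lexx _) (opnormM _ _)))//.
  rewrite (le_trans (lerD (lexx _) (ler_wpM2r q0 IH)))// -/q.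
  by rewrite -(ler_pM2r q1) mulrDl mulrAC mulVf ?gt_eqF//; nra.
have s_dist n k : opnorm (s (n + k)%N - s n) <= q ^+ n * (1 - q)^-1.
  elim: n => [|n IH]; first by rewrite subr0 expr0 mul1r.
  rewrite addSn /= opprD addrACA subrr add0r -mulrBl.
  rewrite (le_trans (opnormM _ _))// exprS mulrC -mulrA.
  by rewrite ler_wpM2l.
have [|c cP] := @bop_cauchy _ _ s.
  move=> e e0; have e20 : 0 < e / 2 by rewrite divr_gt0.
  have q01 : 0 <= q < 1 by rewrite q0.
  have [N NP] := geometric_small (1 - q)^-1 q01 e20; exists N => m n Nm Nn.
  have sN k : (N <= k)%N -> opnorm (s k - s N) <= e / 2.
    by move=> /subnKC <-; rewrite (le_trans (s_dist _ _))// NP.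
  rewrite -nrm_bopE (le_trans (ler_nrm_dist _ (s N) _))// (nrmB (s N)) !nrm_bopE.
  by have := sN m Nm; have := sN n Nn; lra.
exists c.
  apply: (closed_nrmP A_alg.1) => e e0; have [N NP] := cP e e0.
  by exists (s N); [exact: As|exact: NP].
apply/eqP; rewrite -subr_eq0; apply/eqP.
apply: (@nrm_le_eps_eq0 _ _ _ (1 + q)) => e e0; have [N NP] := cP e e0.
have -> : c - (h + c * h) = (c - s N.+1) + (s N - c) * h.
  by rewrite /= mulrBl -[RHS]addrA [- (h + s N * h)]opprD -[- h - _ + _]addrA addKr opprD.
rewrite (le_trans (ler_nrmD _ _))// mulrDr mulr1 lerD//; first exact: NP.
by rewrite (le_trans (opnormM _ _))// ler_wpM2r// -nrm_bopE nrmB NP.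
Qed.

End Algebras.

(** * Homomorphisms of operator algebras *)

Section AlgHom.
Variables (R : realType) (H K : hilbert R) (A : set (bop H)).
Hypothesis A_alg : operator_algebra A.
Variables (phi : bop H -> bop K).
Hypothesis phi_hom : alg_hom A phi.

Lemma alg_homP (z : R[i]) a b : A a -> A b -> phi (z *: a + b) = z *: phi a + phi b.
Proof. exact: phi_hom.1. Qed.
Lemma alg_homM a b : A a -> A b -> phi (a * b) = phi a * phi b.
Proof. exact: phi_hom.2. Qed.
Lemma alg_hom0 : phi 0 = 0.
Proof.
have := alg_homP (-1) (opalg0 A_alg) (opalg0 A_alg).
by rewrite scaler0 addr0 scaleN1r addNr.
Qed.
Lemma alg_homD a b : A a -> A b -> phi (a + b) = phi a + phi b.
Proof. by move=> Aa Ab; rewrite -[a in LHS]scale1r alg_homP// scale1r. Qed.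
Lemma alg_homZ (z : R[i]) a : A a -> phi (z *: a) = z *: phi a.
Proof.
move=> Aa; rewrite -[z *: a]addr0 alg_homP//; last exact: opalg0.
by rewrite alg_hom0 addr0.
Qed.
Lemma alg_homB a b : A a -> A b -> phi (a - b) = phi a - phi b.
Proof.
move=> Aa Ab; have -> : a - b = (-1) *: b + a by rewrite scaleN1r addrC.
by rewrite alg_homP// scaleN1r addrC.
Qed.
Lemma alg_hom_sum I (r : seq I) (F : I -> bop H) : (forall i, A (F i)) ->
  phi (\sum_(i <- r) F i) = \sum_(i <- r) phi (F i).
Proof.
move=> AF; elim: r => [|i r IH]; first by rewrite !big_nil alg_hom0.
by rewrite !big_cons alg_homD ?IH//; exact: opalg_sum.
Qed.

End AlgHom.

Section StarHom.
Variables (R : realType) (K L : hilbert R) (B : set (bop K)).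
Hypothesis B_cstar : cstar_algebra B.
Let B_alg : operator_algebra B := B_cstar.1.

Lemma cstar_adj b c : B b -> adjoint b c -> B c.
Proof.
by move=> Bb bc; have [c' Bc' bc'] := B_cstar.2 b Bb; rewrite (adjoint_uniq bc bc').
Qed.

(* If t = |phi b| > |b|, then 1 - b^* b / t^2 is invertible by a Neumann series,
   hence so is its image 1 - phi(b)^* phi(b) / t^2, which is impossible since t is
   the norm of phi(b). *)
Lemma star_hom_contractive (phi : bop K -> bop L) b :
  star_hom B phi -> B b -> opnorm (phi b) <= opnorm b.
Proof.
move=> [phi_hom phi_star] Bb; rewrite leNgt; apply/negP.
set t := opnorm (phi b) => bt.
have t0 : 0 < t by rewrite (le_lt_trans (opnorm_ge0 b)).
have [b' Bb' bb'] := B_cstar.2 b Bb.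
pose r : R := t ^-2; have r0 : 0 < r by rewrite invr_gt0 exprn_gt0.
pose h := r%:C *: (b' * b).
have nr : complex.Re `|r%:C| = r by rewrite ger0_norm// lecR ltW.
have Bb'b : B (b' * b) by exact: opalgM.
have Bh : B h by exact: opalgZ.
have h1 : opnorm h < 1.
  rewrite -nrm_bopE nrmZ nr nrm_bopE.
  apply: le_lt_trans (_ : r * opnorm b ^+ 2 < 1).
    rewrite ler_pM2l// (le_trans (opnormM _ _))// expr2.
    by rewrite ler_wpM2r ?opnorm_ge0// opnorm_adjoint.
  rewrite mulrC ltr_pdivrMr ?exprn_gt0// mul1r ltr_pXn2r// nnegrE ?opnorm_ge0//.
have [c Bc ch] := neumann_series B_alg Bh h1.
have pc : phi c = phi h + phi c * phi h.
  rewrite {1}ch (alg_homD phi_hom)//; last exact: opalgM.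
  by rewrite (alg_homM phi_hom).
have ph v : phi h v = r%:C *: phi b' (phi b v).
  by rewrite (alg_homZ B_alg phi_hom)// (alg_homM phi_hom).
pose k := 1 + opnorm (phi c).
have k1 : 1 <= k by rewrite lerDl opnorm_ge0.
(* For [w = v - phi h v] the left inverse gives [nrm v <= k * nrm w]. Expanding [nrm w ^+ 2] and
   bounding [nrm (phi h v)] by [nrm v] produces the right-hand side. *)
have main v : nrm v ^+ 2 <= 2 * k ^+ 2 * (nrm v ^+ 2 - r * nrm (phi b v) ^+ 2).
  pose w := v - phi h v.
  have vw : v = w + phi c w.
    rewrite /w bopB [in phi c v]pc bopDE bopME addrK.
    by rewrite subrK.
  have vk : nrm v <= k * nrm w.
    by rewrite {1}vw (le_trans (ler_nrmD _ _))// mulrDl mul1r lerD2l nrm_bop_le.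
  have {}vk : nrm v ^+ 2 <= k ^+ 2 * nrm w ^+ 2.
    by rewrite -exprMn ler_pXn2r ?nnegrE ?mulr_ge0 ?nrm_ge0// (le_trans _ k1).
  apply: le_trans vk _; rewrite [2 * _]mulrC -[leRHS]mulrA ler_pM2l; last first.
    by rewrite exprn_gt0// (lt_le_trans ltr01).
  have hv : nrm (phi h v) <= nrm v.
    rewrite ph nrmZ nr [leLHS]mulrC.
    rewrite ler_pdivrMr ?exprn_gt0// (le_trans (nrm_bop_le _ _))//.
    apply: (@le_trans _ _ (t * (t * nrm v))); last by rewrite mulrA -expr2 mulrC.
    apply: ler_pM; rewrite ?opnorm_ge0 ?nrm_ge0 ?nrm_bop_le//.
    exact: (opnorm_adjoint (phi_star _ _ Bb Bb' bb')).
  have hv2 : nrm (phi h v) ^+ 2 <= nrm v ^+ 2.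
    by rewrite ler_pXn2r ?nnegrE ?nrm_ge0.
  have vh : rinner v (phi h v) = r * nrm (phi b v) ^+ 2.
    rewrite ph rinnerZr -rinnerxx; congr (_ * _).
    by rewrite /rinner (phi_star _ _ Bb Bb' bb').
  rewrite nrm_sqrB vh; lra.
have k0 : 0 < k by rewrite (lt_le_trans ltr01).
have k20 : 0 < 2 * k ^+ 2 by rewrite mulr_gt0// exprn_gt0.
pose rho := 1 - (2 * k ^+ 2)^-1.
have rho0 : 0 <= rho.
  rewrite subr_ge0 invf_le1//; have := exprn_ege1 2 k1; lra.
have rho1 : rho < 1 by rewrite ltrBlDr ltrDl invr_gt0.
(* Rearranged, [main] bounds [phi b] by [t * Num.sqrt rho], strictly less than its norm [t] since
   [rho < 1]. *)
have tb : t <= t * Num.sqrt rho.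
  apply: opnorm_le => [|v]; first by rewrite mulr_ge0 ?sqrtr_ge0 ?ltW.
  rewrite -(@ler_pXn2r _ 2) ?nnegrE ?mulr_ge0 ?nrm_ge0 ?sqrtr_ge0 ?(ltW t0)//.
  rewrite !exprMn sqr_sqrtr// -mulrA -ler_pdivrMl ?exprn_gt0//.
  rewrite -/r /rho mulrBl mul1r lerBrDr -lerBrDl mulrC ler_pdivrMr//.
  by rewrite mulrC main.
have : Num.sqrt rho < 1.
  by rewrite -[ltRHS]sqrtr1 ltr_sqrt.
by apply/negP; rewrite -leNgt -(ler_pM2l t0) mulr1.
Qed.

(** An induction principle for the generated C*-algebra. [Q] is not assumed stable under adjoints,
    so [D] collects the elements satisfying [Q] together with their adjoints; [D] is a C*-algebra
    containing [S], hence all of [B]. *)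
Lemma cstar_gen_ind (S : set (bop K)) (Q : bop K -> Prop) :
  cstar_gen S = B ->
  Q 0 ->
  (forall (z : R[i]) a b, B a -> B b -> Q a -> Q b -> Q (z *: a + b)) ->
  (forall a b, B a -> B b -> Q a -> Q b -> Q (a * b)) ->
  (forall b, B b ->
     (forall e : R, 0 < e -> exists b', [/\ B b', Q b' & opnorm (b - b') <= e]) ->
     Q b) ->
  (forall a, S a -> Q a) ->
  (forall a b, S a -> adjoint a b -> Q b) ->
  forall b, B b -> Q b.
Proof.
move=> SB Q0 QP QM Qlim QS QSadj b Bb.
pose D := [set b | [/\ B b, Q b & forall c, adjoint b c -> Q c]].
suff : cstar_algebra D /\ S `<=` D.
  by move=> DC; move: Bb; rewrite -SB => /(_ D DC)[].
have Dadj b1 : D b1 -> exists2 c, D c & adjoint b1 c.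
  move=> [Bb1 Qb1 Qadj]; have [c Bc bc] := B_cstar.2 _ Bb1; exists c => //.
  split=> //; first exact: Qadj.
  by move=> d /(adjoint_uniq (adjoint_sym bc)) <-.
split; first split; first split.
- apply: nrm_closed => x xD.
  have Bx : B x.
    by apply: (closed_nrmP B_alg.1) => e /xD[y [By _ _] xy]; exists y.
  split=> //.
    apply: Qlim => // e /xD[y [By Qy _] xy]; by exists y.
  move=> c xc; apply: Qlim; first exact: cstar_adj xc.
  move=> e /xD[y Dy xy]; have [d Dd yd] := Dadj _ Dy; case: Dd => Bd Qd _.
  exists d; split=> //; apply: le_trans xy.
  apply: opnorm_adjoint; have := adjointP (-1) yd xc.
  by rewrite rmorphN rmorph1 !scaleN1r ![- _ + _]addrC.
- split=> [|z a a1 Da Da1|a a1 Da Da1].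
  + split=> //; first exact: opalg0.
    by move=> c /(adjoint_uniq (adjoint0 (H:=K))) <-.
  + have [c Dc ac] := Dadj _ Da; have [c1 Dc1 ac1] := Dadj _ Da1.
    move: Da Da1 Dc Dc1 => [Ba Qa _] [Ba1 Qa1 _] [Bc Qc _] [Bc1 Qc1 _].
    split; [exact: opalgP|exact: QP|].
    by move=> d /(adjoint_uniq (adjointP z ac ac1)) <-; exact: QP.
  + have [c Dc ac] := Dadj _ Da; have [c1 Dc1 ac1] := Dadj _ Da1.
    move: Da Da1 Dc Dc1 => [Ba Qa _] [Ba1 Qa1 _] [Bc Qc _] [Bc1 Qc1 _].
    split; [exact: opalgM|exact: QM|].
    by move=> d /(adjoint_uniq (adjointM ac ac1)) <-; exact: QM.
- exact: Dadj.
- move=> a Sa; split; [|exact: QS|by move=> c; exact: QSadj].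
  by rewrite -SB => E [_ SE]; exact: SE.
Qed.

End StarHom.

(** * Parseval frames of finite-dimensional subspaces *)

Section Frames.
Variables (R : realType) (K : hilbert R).
Implicit Types (x y z : K) (f g : seq K) (S T : bop K).

Lemma normc_sqr (c : R[i]) : complex.Re `|c| ^+ 2 = complex.Re (c * c^*%C).
Proof.
case: c => a b; rewrite normc_def /= sqr_sqrtr ?addr_ge0 ?sqr_ge0//; ring.
Qed.

Lemma norm_inner_le x y : complex.Re `|inner K x y| <= nrm x * nrm y.
Proof.
set c := inner K x y; have [->|n0] := eqVneq (complex.Re `|c|) 0.
  by rewrite mulr_ge0 ?nrm_ge0.
have n1 : 0 < complex.Re `|c| by rewrite lt_def n0 Re_norm_ge0.
rewrite -(ler_pM2r n1) -expr2 normc_sqr mulrC.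
(* Rotating [y] by [c] makes the inner product real, which reduces the claim to [rinner_le]. *)
have -> : c^*%C * c = inner K x (c *: y) by rewrite innerZr.
by apply: le_trans (rinner_le _ _) _; rewrite nrmZ mulrCA mulrC.
Qed.

Section RankOne.
Variable y : K.
Fact rank_one_linear : linear (fun x => inner K x y *: y).
Proof. by move=> c x z; rewrite innerDl innerZl scalerDl scalerA. Qed.
Fact rank_one_bounded : exists M : R, forall x, nrm (inner K x y *: y) <= M * nrm x.
Proof.
exists (nrm y ^+ 2) => x; rewrite nrmZ expr2 -mulrA mulrC ler_wpM2l ?nrm_ge0//.
by rewrite (mulrC (nrm y)) norm_inner_le.
Qed.
Definition rank_one := Bop rank_one_linear rank_one_bounded.
End RankOne.

Definition frame_op f : bop K := \sum_(y <- f) rank_one y.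

Lemma frame_opE f x : frame_op f x = \sum_(y <- f) inner K x y *: y.
Proof. exact: bop_sumE. Qed.

Lemma frame_op_adj f : adjoint (frame_op f) (frame_op f).
Proof.
move=> x y; rewrite !frame_opE inner_suml inner_sumr; apply: eq_bigr => z _.
by rewrite innerZl innerZr /= mulrC; congr (_ * _); exact: innerC.
Qed.

(** For such [f], [frame_op f] is the orthogonal projection onto the span of [f]. Unlike
    orthonormality, the condition tolerates zero vectors, so no linear independence has to be
    tracked. *)
Definition parseval f := forall y, y \in f -> frame_op f y = y.

Lemma parseval_idem f x : parseval f -> frame_op f (frame_op f x) = frame_op f x.
Proof.
move=> fP; rewrite [in LHS](frame_opE f x) bop_sum frame_opE.
by apply: eq_big_seq => y yf; rewrite bopZ fP.
Qed.

Lemma parseval_contr f x : parseval f -> nrm (frame_op f x) <= nrm x.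
Proof.
move=> fP; apply: nrm_rinner_le; first exact: nrm_ge0.
rewrite -rinnerxx {1}/rinner -(frame_op_adj f) parseval_idem//.
by rewrite mulrC; exact: rinner_le.
Qed.

(** The second and third clauses together say that [f] and [g] have the same span. *)
Lemma gram_schmidt g : exists f, [/\ parseval f,
  forall W : set K, lin_subspace W -> (forall x, x \in g -> W x) ->
    forall y, y \in f -> W y
  & forall x, x \in g -> frame_op f x = x].
Proof.
elim: g => [|x g [f [fP fW gf]]]; first by exists [::]; split=> //.
(* If [x] already lies in the span of [f], then [y0 = 0] and the vector added is [0], which a
   Parseval list allows. *)
pose y0 := x - frame_op f x; pose c := ((nrm y0)^-1)%:C; pose y := c *: y0.
have Py : frame_op f y = 0 by rewrite bopZ bopB parseval_idem// subrr scaler0.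
have yz z : inner K (frame_op f z) y = 0.
  by rewrite (frame_op_adj f) Py inner0r.
have yy0 : inner K y0 y *: y = y0.
  have [->|n0] := eqVneq y0 0; first by rewrite inner0l scale0r.
  have cc : c^*%C = c by exact: conjc_real.
  rewrite /y innerZr cc innerE -nrmE scalerA /c -rmorphXn -!rmorphM /=.
  have nn0 : nrm y0 != 0 by apply: contra_neq n0 => /nrm_eq0.
  rewrite (_ : _ * _ = 1) ?scale1r//; by field.
have yy : inner K y y *: y = y.
  by rewrite {1}/y innerZl -scalerA yy0.
have PE z : frame_op (y :: f) z = inner K z y *: y + frame_op f z.
  by rewrite /frame_op big_cons bopDE.
have Pfix z : frame_op f z = z -> frame_op (y :: f) z = z.
  by move=> fz; rewrite PE fz -fz yz scale0r add0r.
exists (y :: f); split.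
- move=> z; rewrite inE => /predU1P[->|zf]; first by rewrite PE yy Py addr0.
  exact/Pfix/fP.
- move=> W WS Wg z; have Wf w : w \in f -> W w.
    by apply: fW => // v vg; apply: Wg; rewrite inE vg orbT.
  rewrite inE => /predU1P[->|/Wf//]; rewrite /y /y0; apply: (lin_subspaceZ WS).
  apply: (lin_subspaceB WS); first by apply: Wg; rewrite mem_head.
  rewrite frame_opE big_seq; elim/big_ind: _ => [|? ?|w wf].
  + by case: WS.
  + exact: (lin_subspaceD WS).
  + by apply: (lin_subspaceZ WS); exact: Wf.
- move=> z; rewrite inE => /predU1P[->|/gf/Pfix//]; rewrite PE.
  have -> : inner K x y = inner K y0 y.
    by rewrite -[x in LHS](subrK (frame_op f x)) innerDl yz addr0.
  by rewrite yy0 subrK.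
Qed.

Lemma frame_sum (V : nmodType) f (F : K -> V) : F 0 = 0 ->
  \sum_(y <- f) F y = \sum_(j < (size f).+1) F f`_j.
Proof.
by move=> F0; rewrite big_ord_recr /= nth_default// F0 addr0 (big_nth 0) big_mkord.
Qed.

(** The definition of [RFD] asks for matrices of size [r.+1]. The extra index reads the default
    vector [0] past the end of [f], so the last row and column vanish. *)
Definition compress f T : 'M[R[i]]_((size f).+1) :=
  \matrix_(i, j) inner K (T f`_j) f`_i.

Lemma compressP f (z : R[i]) S T :
  compress f (z *: S + T) = z *: compress f S + compress f T.
Proof. by apply/matrixP => i j; rewrite !mxE bopDE bopZE innerDl innerZl. Qed.

(** Summing over the frame vectors inserts the projection [frame_op f], so [compress f] is
    multiplicative on operators that absorb it. *)
Lemma compressM f S T :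
  compress f S *m compress f T = compress f (S * frame_op f * T).
Proof.
apply/matrixP => i k; rewrite !mxE !bopME frame_opE bop_sum inner_suml.
rewrite frame_sum; last by rewrite inner0r scale0r bop0 inner0l.
by apply: eq_bigr => j _; rewrite !mxE bopZ innerZl mulrC.
Qed.

Lemma compress_adj f S T : adjoint S T ->
  compress f T = map_mx (@Num.conj R[i]) (compress f S)^T.
Proof.
by move=> ST; apply/matrixP => i j; rewrite !mxE (adjoint_sym ST) innerC.
Qed.

(** An operator that lives on the span of [f] from both sides is determined by its coefficients
    against the frame. *)
Lemma compress_eq0 f T : compress f T = 0 ->
  (forall x, frame_op f (T x) = T x) -> (forall x, T (frame_op f x) = T x) -> T = 0.
Proof.
move=> T0 PT TP; apply: bop_ext => x; rewrite -TP frame_opE bop_sum frame_sum.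
  apply: big1 => j _; rewrite bopZ -PT frame_opE frame_sum ?inner0r ?scale0r//.
  rewrite big1 ?scaler0// => i _; have := congr1 (fun M : 'M_ _ => M i j) T0.
  by rewrite !mxE => ->; rewrite scale0r.
by rewrite inner0r scale0r bop0.
Qed.

(** The sum equals the inner product of [frame_op f x] with [x], and [frame_op f] is a
    contraction. *)
Lemma frame_bessel f x : parseval f ->
  \sum_(j < (size f).+1) complex.Re `|inner K x f`_j| ^+ 2 <= nrm x ^+ 2.
Proof.
move=> fP; apply: le_trans (_ : rinner (frame_op f x) x <= _); last first.
  rewrite (le_trans (rinner_le _ _))// expr2 ler_wpM2r ?nrm_ge0//.
  exact: parseval_contr.
rewrite /rinner frame_opE inner_suml frame_sum; last first.
  by rewrite inner0r scale0r inner0l.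
rewrite raddf_sum; apply: ler_sum => j _.
by rewrite innerZl /= (innerC f`_j) normc_sqr.
Qed.

(** Expanding [nrm u ^+ 2] along one copy of [u] and applying the inequality between [2ab] and
    [a^2 + b^2] termwise gives [2 * nrm u ^+ 2 <= s + b]; Bessel absorbs [b]. *)
Lemma frame_comb_le f (v : 'I_(size f).+1 -> R[i]) : parseval f ->
  nrm (\sum_j v j *: f`_j) ^+ 2 <= \sum_j complex.Re `|v j| ^+ 2.
Proof.
move=> fP; set u := \sum_j _; set s := \sum_j _.
have := frame_bessel u fP; set b := \sum_(j < _) _ => bu.
suff : nrm u ^+ 2 *+ 2 <= s + b by rewrite mulr2n => h; lra.
rewrite -rinnerxx {1}/rinner {1}/u inner_suml raddf_sum -sumrMnl -big_split.
apply: ler_sum => j _; rewrite innerZl /= (innerC _ u) !normc_sqr.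
case: (v j) (inner K u f`_j) => a b' [c d] /=.
have := sqr_ge0 (a - c); have := sqr_ge0 (b' - d); lra.
Qed.

(** The matrix factors as synthesis along [f], then [T], then the coefficients against [f]; the
    outer two maps are contractions by the two preceding lemmas. *)
Lemma mx2norm_compress f T : parseval f -> mx2norm (compress f T) <= opnorm T.
Proof.
move=> fP; apply: ge_sup.
  exists (l2norm (fun k => (compress f T *m (0 : 'cV__)) k 0 : R[i]^o)); exists 0 => //=.
  rewrite /l2norm big1 ?sqrtr0// => k _.
  by rewrite mxE [nrm _]nrm0 expr0n.
move=> _ [v /= v1 <-]; pose u := \sum_j v j 0 *: f`_j.
have l2E r (w : 'I_r -> R[i]) :
  l2norm (fun k => w k : R[i]^o) = Num.sqrt (\sum_k complex.Re `|w k| ^+ 2) by [].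
have u1 : nrm u <= 1.
  rewrite (le_trans _ v1)// l2E -[leLHS]ger0_norm ?nrm_ge0// -sqrtr_sqr.
  by rewrite ler_wsqrtr// frame_comb_le.
rewrite l2E.
have E k : (compress f T *m v) k 0 = inner K (T u) f`_k.
  rewrite mxE bop_sum inner_suml; apply: eq_bigr => j _.
  by rewrite mxE bopZ innerZl mulrC.
under eq_bigr do rewrite E.
rewrite (le_trans (ler_wsqrtr (frame_bessel _ fP)))// sqrtr_sqr ger0_norm ?nrm_ge0//.
by rewrite (le_trans (nrm_bop_le _ _))// ler_piMr ?opnorm_ge0.
Qed.

End Frames.

(** * Ideals with a contractive approximate identity *)

Section Eventually.
Variable L : directedSet.

Definition eventually_net (P : L -> Prop) := exists l0, forall l, dle l0 l -> P l.

Lemma eventually_netI P Q :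
  eventually_net P -> eventually_net Q -> eventually_net (fun l => P l /\ Q l).
Proof.
move=> [l lP] [m mQ]; have [n ln mn] := dle_directed l m; exists n => k nk.
by split; [apply/lP/(dle_trans ln)|apply/mQ/(dle_trans mn)].
Qed.

Lemma eventually_net_ex P : eventually_net P -> exists l, P l.
Proof. by move=> [l lP]; exists l; apply/lP/dle_refl. Qed.

End Eventually.

Section Ideal.
Variables (R : realType) (H K : hilbert R) (A J : set (bop H)).
Variables (L : directedSet) (e : L -> bop H) (mu : bop H -> bop K).
Hypotheses (A_alg : operator_algebra A) (J_ideal : closed_ideal A J).
Hypothesis e_cai : contractive_approx_id J e.
Hypotheses (mu_hom : alg_hom A mu)
  (mu_contr : forall a, A a -> opnorm (mu a) <= opnorm a)
  (mu_adj : forall a, A a -> exists c, adjoint (mu a) c).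
Implicit Types (a b j : bop H) (x y v : K).

Let JA j : J j -> A j.
Proof. by case: J_ideal => sJA _ _ _ _; exact: sJA. Qed.

Let eJ l : J (e l). Proof. by case: e_cai. Qed.

Let JMr a j : A a -> J j -> J (j * a).
Proof. by move=> Aa Jj; case: J_ideal => _ _ _ _ /(_ _ _ Aa Jj)[]. Qed.

Lemma cai_cvg j (d : R) : J j -> 0 < d -> eventually_net (fun l : L =>
  opnorm (e l * j - j) <= d /\ opnorm (j * e l - j) <= d).
Proof.
move=> Jj d0; have [_ _ /(_ j Jj)[cl cr]] := e_cai.
have nb : nbhs j [set T : bop H | opnorm (T - j) <= d].
  apply/nbhs_normP; exists d%:C => /=; first by rewrite ltcR.
  by move=> T /=; rewrite -nrmE ltcR nrmB nrm_bopE => /ltW.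
by apply: eventually_netI; [exact: cl nb|exact: cr nb].
Qed.

Lemma mu_e_le l x : nrm (mu (e l) x) <= nrm x.
Proof.
rewrite (le_trans (nrm_bop_le _ _))// ler_piMl ?nrm_ge0//.
by rewrite (le_trans (mu_contr (JA (eJ l))))//; case: e_cai.
Qed.

Definition ideal_range : set K := [set y | forall d : R, 0 < d ->
  eventually_net (fun l : L => nrm (mu (e l) y - y) <= d)].

(** This turns out to be the orthogonal complement of [ideal_range]: the two inclusions are
    [ideal_range_orthogonal] and [ideal_kernel_orthogonal]. *)
Definition ideal_kernel : set K := [set v | forall j, J j -> mu j v = 0].

Lemma ideal_range_subspace : lin_subspace ideal_range.
Proof.
split=> [d d0|c x y Nx Ny d d0].
  have [l0] := dcar_inhabited L; exists l0 => l _.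
  by rewrite bop0 subrr nrm0 ltW.
pose M := complex.Re `|c| + 1.
have M0 : 0 < M by rewrite ltr_wpDl// Re_norm_ge0.
have [l0 lP] := eventually_netI (Nx _ (divr_gt0 d0 M0)) (Ny _ (divr_gt0 d0 M0)).
exists l0 => l /lP[xl yl].
rewrite bopD bopZ opprD addrACA -scalerBr (le_trans (ler_nrmD _ _))// nrmZ.
have -> : d = complex.Re `|c| * (d / M) + d / M.
  by rewrite /M; field; rewrite gt_eqF.
by rewrite lerD// ler_wpM2l// Re_norm_ge0.
Qed.

Lemma ideal_range_closed : closed ideal_range.
Proof.
apply: nrm_closed => x xN d d0; have d30 : 0 < d / 3 by rewrite divr_gt0.
have [y Ny xy] := xN _ d30; have [l0 lP] := Ny _ d30; exists l0 => l /lP yl.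
have -> : mu (e l) x - x = mu (e l) (x - y) + (mu (e l) y - y) + (y - x).
  by rewrite bopB !subrKA.
rewrite (le_trans (ler_nrmD _ _))// -lerBrDr (le_trans (ler_nrmD _ _))//.
have := mu_e_le l (x - y); rewrite (nrmB y); lra.
Qed.

Lemma ideal_range_mu j x : J j -> ideal_range (mu j x).
Proof.
move=> Jj d d0; have x1 : 0 < nrm x + 1 by rewrite ltr_wpDl ?nrm_ge0.
have [l0 lP] := cai_cvg Jj (divr_gt0 d0 x1); exists l0 => l /lP[jl _].
have Aj := JA Jj; have Ae := JA (eJ l).
rewrite -bopME -(alg_homM mu_hom)// -bopBE -(alg_homB mu_hom)//; last first.
  exact: opalgM.
rewrite (le_trans (nrm_bop_le _ _))//.
apply: le_trans (_ : d / (nrm x + 1) * nrm x <= _).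
  rewrite ler_wpM2r ?nrm_ge0// (le_trans (mu_contr _))//.
  by apply: opalgB => //; exact: opalgM.
by rewrite mulrAC ler_pdivrMr// ler_pM2l// lerDl.
Qed.

(** Replace [y] by [mu (e l) y], with [l] late enough for the error to be small and with
    [opnorm (a * e l) <= d]. The latter is assumed only cofinally often, which is all that a limit
    inferior provides. *)
Lemma ideal_range_bound a (d : R) y : A a ->
  (forall l0 : L, exists2 l, dle l0 l & opnorm (a * e l) <= d) ->
  ideal_range y -> nrm (mu a y) <= d * nrm y.
Proof.
move=> Aa ad Ny; rewrite -subr_le0; apply: (@le0_of_le_eps _ _ (opnorm (mu a))).
move=> r r0; have [l0 lP] := Ny r r0; have [l l0l ael] := ad l0.
have {lP} := lP l l0l; rewrite nrmB => yl.
rewrite lerBlDr -[y in mu a y](subrK (mu (e l) y)) bopD.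
rewrite (le_trans (ler_nrmD _ _))// lerD//.
  rewrite (le_trans (nrm_bop_le _ _))// mulrC.
  by rewrite ler_wpM2r ?opnorm_ge0.
have Ae := JA (eJ l).
rewrite -bopME -(alg_homM mu_hom)// (le_trans (nrm_bop_le _ _))//.
by rewrite ler_wpM2r ?nrm_ge0// (le_trans (mu_contr _))//; exact: opalgM.
Qed.

(** Expanding the square and using that [S] is also a contraction bounds the left-hand side by twice
    the real inner product of [y] with [y - T y]. *)
Lemma contraction_adjoint_fix (T S : bop K) y : adjoint T S ->
  opnorm T <= 1 -> nrm (S y - y) ^+ 2 <= 2 * (nrm y * nrm (T y - y)).
Proof.
move=> TS T1; have Sy : nrm (S y) ^+ 2 <= nrm y ^+ 2.
  rewrite ler_pXn2r ?nnegrE ?nrm_ge0// (le_trans (nrm_bop_le _ _))//.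
  rewrite ler_piMl ?nrm_ge0//; exact: le_trans (opnorm_adjoint TS) T1.
have Syy : rinner (S y) y = rinner y (T y).
  by rewrite rinnerC /rinner -TS -/(rinner _ _) rinnerC.
have := rinner_le y (y - T y); rewrite nrmB rinnerDr rinnerNr rinnerxx.
rewrite nrm_sqrB Syy; lra.
Qed.

(** Up to a small error, [nrm z ^+ 2] pairs [mu (e l) x] with [c z]. As [mu (e l) x] is in the
    range, [c z] may be replaced by its projection [u]; moving [mu (e l)] across gives [s u], close
    to [u], which is orthogonal to [x]. *)
Lemma ideal_range_orthogonal x :
  (forall y, ideal_range y -> inner K x y = 0) -> ideal_kernel x.
Proof.
move=> xN j Jj; set z := mu j x; have Aj := JA Jj.
have [c jc] := mu_adj Aj.
have [u Nu uP] := orthogonal_projection ideal_range_subspace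
  ideal_range_closed (c z).
apply: nrm_eq0; apply/eqP; rewrite -sqrf_eq0 eq_le sqr_ge0 andbT.
apply: (@le0_of_le_eps _ _ (nrm x * nrm z + nrm x * (1 + nrm u))) => d d0.
(* The tolerance for [u] is [d ^+ 2] because [contraction_adjoint_fix] costs a square root. *)
have [l [[_ jl] ul]] := eventually_net_ex
  (eventually_netI (cai_cvg Jj d0) (Nu _ (exprn_gt0 2 d0))).
have Ae := JA (eJ l); have [s es] := mu_adj Ae.
have Ne : ideal_range (mu (e l) x) by exact: ideal_range_mu.
have zE : z = mu (j - j * e l) x + mu j (mu (e l) x).
  rewrite (alg_homB mu_hom)//; last exact: opalgM.
  by rewrite (alg_homM mu_hom)// bopBE bopME subrK.
rewrite -rinnerxx {1}zE rinnerDl mulrDr lerD//.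
  rewrite (le_trans (rinner_le _ _))// mulrA ler_wpM2r ?nrm_ge0//.
  rewrite (le_trans (nrm_bop_le _ _))// ler_wpM2r ?nrm_ge0//.
  rewrite (le_trans (mu_contr _))//; first by apply: opalgB => //; exact: opalgM.
  by rewrite -nrm_bopE nrmB.
have -> : rinner (mu j (mu (e l) x)) z = rinner x (s u - u).
  rewrite rinnerDr rinnerNr {3}/rinner xN// subr0 /rinner jc -es.
  rewrite -[c z in LHS](subrK u) innerDr.
  by rewrite (innerC _ (c z - u)) uP// rmorph0 add0r.
rewrite (le_trans (rinner_le _ _))// mulrCA ler_wpM2l ?nrm_ge0//.
have d1 : 0 <= d * (1 + nrm u) by rewrite mulr_ge0 ?addr_ge0 ?nrm_ge0 ?ltW.
rewrite -(@ler_pXn2r _ 2) ?nnegrE ?nrm_ge0//.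
have e1 : opnorm (mu (e l)) <= 1.
  by rewrite (le_trans (mu_contr Ae))//; case: e_cai.
rewrite (le_trans (contraction_adjoint_fix u es e1))//.
have nu := nrm_ge0 u.
apply: le_trans (_ : 2 * (nrm u * d ^+ 2) <= _).
  by rewrite ler_pM2l// ler_wpM2l.
have := mulr_ge0 (sqr_ge0 d) (addr_ge0 (@ler01 R) (sqr_ge0 (nrm u))); lra.
Qed.

(** The projection [u] of [v] onto the range is killed by [J], since both [v] and [v - u] are. It is
    also fixed in the limit by the [mu (e l)], hence it is [0]. *)
Lemma ideal_kernel_orthogonal v y :
  ideal_kernel v -> ideal_range y -> inner K v y = 0.
Proof.
move=> Zv; have [u Nu uP] := orthogonal_projection ideal_range_subspace
  ideal_range_closed v.
suff u0 : u = 0 by move=> Ny; have := uP y Ny; rewrite u0 subr0.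
have Zu : ideal_kernel u.
  move=> j Jj; have /(_ j Jj) := ideal_range_orthogonal uP.
  by rewrite bopB Zv// sub0r => /eqP; rewrite oppr_eq0 => /eqP.
apply: (@nrm_le_eps_eq0 _ _ _ 1) => d d0.
have [l] := eventually_net_ex (Nu d d0).
by rewrite Zu// sub0r nrmN mulr1.
Qed.

Lemma ideal_kernel_subspace : lin_subspace ideal_kernel.
Proof.
split=> [j _|c x y Zx Zy j Jj]; first by rewrite bop0.
by rewrite bopD bopZ Zx// Zy// scaler0 addr0.
Qed.

Lemma ideal_kernel_mu a v : A a -> ideal_kernel v -> ideal_kernel (mu a v).
Proof.
move=> Aa Zv j Jj; have Aj := JA Jj.
by rewrite -bopME -(alg_homM mu_hom)// Zv//; exact: JMr.
Qed.

Lemma ideal_decomposition : exists p : K -> K, forall x,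
  [/\ ideal_range (p x), ideal_kernel (x - p x)
    & forall y, ideal_range y -> inner K (x - p x) y = 0].
Proof.
have /choice[p pP] x : exists u, [/\ ideal_range u, ideal_kernel (x - u)
    & forall y, ideal_range y -> inner K (x - u) y = 0].
  have [u Nu uP] := orthogonal_projection ideal_range_subspace ideal_range_closed x.
  by exists u; split=> //; exact: ideal_range_orthogonal.
by exists p.
Qed.

Lemma finite_dim_invariant_frame (g : seq K) : finite_dim_quotient A J ->
  (forall x, x \in g -> ideal_kernel x) ->
  exists f, [/\ parseval f, forall y, y \in f -> ideal_kernel y,
    forall x, x \in g -> frame_op f x = x
  & forall a x, A a -> frame_op f (mu a (frame_op f x)) = mu a (frame_op f x)].
Proof.
(* On the kernel [mu a] depends only on the class of [a] modulo [J], so the span of [G] contains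
   every [mu a x] with [x] in [g]. The list [g] is added because [A] need not have a unit. *)
move=> [n [b Ab bP]] gZ; pose G := g ++ [seq mu (b k) x | k <- enum 'I_n, x <- g].
have GZ x : x \in G -> ideal_kernel x.
  rewrite mem_cat => /orP[/gZ//|/allpairsP[[k y] /= [_ /gZ Zy ->]]].
  exact: ideal_kernel_mu.
have [f [fP fW Gf]] := gram_schmidt G.
have fZ := fW _ ideal_kernel_subspace GZ.
exists f; split=> //; first by move=> x xg; apply: Gf; rewrite mem_cat xg.
have gfix a x : A a -> x \in g -> frame_op f (mu a x) = mu a x.
  move=> Aa xg; have [z Jz] := bP a Aa.
  have Asum : A (\sum_k z k *: b k).
    by apply: opalg_sum => // k; exact: opalgZ.
  have -> : mu a x = \sum_k z k *: mu (b k) x.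
    have -> : a = (a - \sum_k z k *: b k) + \sum_k z k *: b k by rewrite subrK.
    rewrite (alg_homD mu_hom)//; last exact: JA.
    rewrite bopDE gZ// add0r.
    rewrite (alg_hom_sum A_alg mu_hom); last by move=> k; exact: opalgZ.
    rewrite bop_sumE; apply: eq_bigr => k _.
    by rewrite (alg_homZ A_alg mu_hom).
  rewrite bop_sum; apply: eq_bigr => k _; rewrite bopZ Gf// mem_cat.
  by apply/orP; right; apply/allpairsP; exists (k, x); rewrite mem_enum.
(* Invariance needs checking only on [G], as [f] lies in every subspace containing [G]; on the
   vectors [mu (b k) w] it follows from [gfix] applied to [c * b k]. *)
have W : lin_subspace [set y | forall a, A a -> frame_op f (mu a y) = mu a y].
  split=> [a Aa|c x y Wx Wy a Aa]; first by rewrite !bop0.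
  by rewrite !bopD !bopZ Wx// Wy.
move=> a x Aa; rewrite [frame_op f x]frame_opE !bop_sum.
apply: eq_big_seq => y yf; rewrite !bopZ; congr (_ *: _).
apply: (fW _ W) => // {}x; rewrite mem_cat => /orP[xg c Ac|]; first exact: gfix.
move=> /allpairsP[[k w] /= [_ wg ->]] c Ac.
have -> : mu c (mu (b k) w) = mu (c * b k) w by rewrite (alg_homM mu_hom).
by apply: gfix => //; exact: opalgM.
Qed.

End Ideal.

(** * Matrix norms *)

Section MatrixNorm.
Variables (R : realType) (H : hilbert R).
Implicit Types (T P : bop H).

Lemma ler_l2norm n (x y : 'I_n -> H) : (forall k, nrm (x k) <= nrm (y k)) ->
  l2norm x <= l2norm y.
Proof.
move=> xy; apply: ler_wsqrtr; apply: ler_sum => k _.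
by rewrite ler_pXn2r ?nnegrE ?nrm_ge0.
Qed.

Lemma nrm_le_l2norm n (x : 'I_n -> H) k : nrm (x k) <= l2norm x.
Proof.
rewrite -[leLHS]ger0_norm ?nrm_ge0// -sqrtr_sqr; apply: ler_wsqrtr.
by rewrite (bigD1 k)//= lerDl sumr_ge0// => j _; exact: sqr_ge0.
Qed.

Lemma l2norm1 (x : 'I_1 -> H) : l2norm x = nrm (x 0).
Proof. by rewrite /l2norm big_ord1 sqrtr_sqr ger0_norm ?nrm_ge0. Qed.

Lemma mx_opnorm_has_sup n (a : 'M[bop H]_n) :
  has_sup [set l2norm (fun j => \sum_k a j k (x k)) |
           x in [set x : 'I_n -> H | l2norm x <= 1]].
Proof.
split.
  exists (l2norm (fun j => \sum_k a j k 0)), (fun=> 0) => //=.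
  by rewrite /l2norm big1 ?sqrtr0// => k _; rewrite nrm0 expr0n.
exists (Num.sqrt (\sum_j (\sum_k opnorm (a j k)) ^+ 2)) => _ [x /= x1 <-].
apply: ler_wsqrtr; apply: ler_sum => j _.
have sum0 : 0 <= \sum_k opnorm (a j k).
  by apply: sumr_ge0 => k _; exact: opnorm_ge0.
rewrite ler_pXn2r ?nnegrE ?nrm_ge0//.
elim/big_ind2: _ => [|r u s v ru sv|k _]; first by rewrite nrm0.
  by rewrite (le_trans (ler_nrmD _ _))// lerD.
rewrite (le_trans (nrm_bop_le _ _))// ler_piMr ?opnorm_ge0//.
exact: le_trans (nrm_le_l2norm x k) x1.
Qed.

(** The new matrix is [a] composed with the diagonal action of [P], which maps the unit ball of the
    power of [H] into itself. *)
Lemma mx_opnorm_mulr_contraction n (a : 'M[bop H]_n) P :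
  (forall x, nrm (P x) <= nrm x) ->
  mx_opnorm (map_mx (fun T => T * P) a) <= mx_opnorm a.
Proof.
move=> P1; apply: ge_sup; first by case: (mx_opnorm_has_sup (map_mx (fun T => T * P) a)).
move=> _ [x /= x1 <-]; apply: (sup_upper_bound (mx_opnorm_has_sup a)).
exists (fun k => P (x k)); first by apply: le_trans x1; exact: ler_l2norm.
by congr l2norm; apply: funext => j; apply: eq_bigr => k _; rewrite mxE.
Qed.

Lemma mx_opnorm_const1 T : mx_opnorm (const_mx T : 'M_1) = opnorm T.
Proof.
congr sup; apply/seteqP; split=> _ [x /= x1 <-].
  exists (x 0); first by rewrite l2norm1 in x1.
  by rewrite l2norm1 big_ord1 mxE.
by exists (fun=> x); rewrite l2norm1// big_ord1 mxE.
Qed.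

End MatrixNorm.

Lemma completely_isometric_opnorm (R : realType) (H K : hilbert R)
    (A : set (bop H)) (mu : bop H -> bop K) a :
  completely_isometric A mu -> A a -> opnorm (mu a) = opnorm a.
Proof.
move=> mu_iso Aa; have := mu_iso 1 (const_mx a).
by rewrite map_const_mx !mx_opnorm_const1; apply=> j k; rewrite mxE.
Qed.

Lemma compression_completely_contractive (R : realType) (H K : hilbert R)
    (A : set (bop H)) (mu : bop H -> bop K) (P : bop K) :
  completely_isometric A mu -> (forall x, nrm (P x) <= nrm x) ->
  completely_contractive A (fun a => mu a * P).
Proof.
move=> mu_iso P1 n a Aa; rewrite -(mu_iso n a Aa).
have -> : map_mx (fun a => mu a * P) a = map_mx (fun T => T * P) (map_mx mu a).
  by apply/matrixP => j k; rewrite !mxE.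
exact: mx_opnorm_mulr_contraction.
Qed.

(** The hypothesis says that the range of [P] is invariant under [mu a] when [P] is a projection;
    the inner [P] in [mu a * P * (mu b * P)] can then be dropped. *)
Lemma compression_alg_hom (R : realType) (H K : hilbert R)
    (A : set (bop H)) (mu : bop H -> bop K) (P : bop K) :
  alg_hom A mu -> (forall a x, A a -> P (mu a (P x)) = mu a (P x)) ->
  alg_hom A (fun a => mu a * P).
Proof.
move=> mu_hom PA; split=> [z a b Aa Ab|a b Aa Ab].
  by rewrite (alg_homP mu_hom)// mulrDl; congr (_ + _); exact: bop_ext.
by rewrite (alg_homM mu_hom)//; apply: bop_ext => x; rewrite !bopME PA.
Qed.

Lemma net_liminf_lt (R : realType) (L : directedSet) (u : L -> R) (d : R) :
  (net_liminf (fun l => (u l)%:E) < d%:E)%E ->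
  forall l0 : L, exists2 l, dle l0 l & u l <= d.
Proof.
move=> ud l0; apply: contrapT => h; move: ud; apply/negP; rewrite -leNgt.
apply: (@le_trans _ _ (ereal_inf [set (u l)%:E | l in [set l | dle l0 l]])).
  apply: le_ereal_inf_tmp => _ [l /= l0l <-]; rewrite lee_fin leNgt; apply/negP => ul.
  by apply: h; exists l => //; exact: ltW.
by apply: ereal_sup_ubound; exists l0.
Qed.

Lemma cvg_ereal0_lt (R : realType) (u : nat -> \bar R) (d : R) :
  u @ \oo --> 0%E -> 0 < d -> exists N, forall n, (N <= n)%N -> (u n < d%:E)%E.
Proof.
move=> u0 d0; have /= := u0 [set x | (x < d%:E)%E].
case; first by apply: open_ereal_lt'; rewrite lte_fin.
by move=> N _ NP; exists N.
Qed.

(** * Approximation by finite-dimensional representations *)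

Section Approximation.
Variables (R : realType) (H K : hilbert R) (A : set (bop H)) (B : set (bop K)).
Variables (mu : bop H -> bop K) (B_max : max_cstar_cover A B mu).
Hypothesis A_opalg : operator_algebra A.
Variables (J : nat -> set (bop H)) (Lambda : nat -> directedSet).
Variable e : forall n : nat, Lambda n -> bop H.
Hypotheses (J_ideal : forall n, closed_ideal A (J n))
  (e_cai : forall n, contractive_approx_id (J n) (@e n))
  (lim_ae : forall a, A a ->
    (fun n => net_liminf (fun l : Lambda n => (opnorm (a * e l))%:E)) @ \oo --> 0%E)
  (A_J_fin : forall n, finite_dim_quotient A (J n)).

Let B_cstar := mcc_cstar B_max.
Let B_alg : operator_algebra B := B_cstar.1.
Let mu_hom := mcc_hom B_max.

Let mu_B a : A a -> B (mu a).
Proof. by move=> Aa; rewrite -(mcc_gen B_max) => E [_ SE]; apply: SE; exists a. Qed.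

Let mu_contr a : A a -> opnorm (mu a) <= opnorm a.
Proof. by move=> Aa; rewrite (completely_isometric_opnorm (mcc_isometric B_max)). Qed.

Let mu_adj a : A a -> exists c, adjoint (mu a) c.
Proof. by move=> /mu_B/(B_cstar.2)[c _ ac]; exists c. Qed.

Let range n := ideal_range (@e n) mu.
Let kernel n := ideal_kernel (J n) mu.

Lemma ideal_projections : exists p : nat -> K -> K, forall n x,
  [/\ range n (p n x), kernel n (x - p n x)
    & forall y, range n y -> inner K (x - p n x) y = 0].
Proof.
have /choice[p pP] n := ideal_decomposition A_opalg (J_ideal n) (e_cai n)
  mu_hom mu_contr mu_adj.
by exists p.
Qed.

Lemma range_mu_small a (d : R) : A a -> 0 < d -> exists N, forall n x,
  (N <= n)%N -> range n x -> nrm (mu a x) <= d * nrm x.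
Proof.
move=> Aa d0; have [N NP] := cvg_ereal0_lt (lim_ae Aa) d0.
exists N => n x /NP/net_liminf_lt ad.
exact: (ideal_range_bound A_opalg (J_ideal n) (e_cai n)).
Qed.

Section Projections.
Variable p : nat -> K -> K.
Hypothesis pP : forall n x, [/\ range n (p n x), kernel n (x - p n x)
  & forall y, range n y -> inner K (x - p n x) y = 0].

Lemma nrm_projection_sqr n x : nrm (p n x) ^+ 2 = rinner x (p n x).
Proof.
have [Np _ /(_ _ Np) xp] := pP n x; rewrite -rinnerxx.
have {}xp : rinner (x - p n x) (p n x) = 0 by rewrite /rinner xp.
by move/eqP: xp; rewrite rinnerDl rinnerNl subr_eq0 => /eqP.
Qed.

Lemma nrm_projection_le n x : nrm (p n x) <= nrm x.
Proof.
by apply: nrm_rinner_le; rewrite ?nrm_ge0// nrm_projection_sqr rinner_le.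
Qed.

(** [f] spans an invariant finite-dimensional subspace and [pi] is a representation of [B] extending
    the restriction of [mu] to it. The last clause makes the projection agree with [1 - p n] on the
    test vectors [g]. *)
Definition adapted (n : nat) (g : seq K) (fpi : seq K * (bop K -> bop K)) :=
  let: (f, pi) := fpi in
  [/\ parseval f, star_hom B pi, forall a, A a -> pi (mu a) = mu a * frame_op f,
      forall a x, A a -> frame_op f (mu a (frame_op f x)) = mu a (frame_op f x)
    & forall x, x \in g -> frame_op f x = x - p n x].

Lemma adapted_ex n g : exists fpi, adapted n g fpi.
Proof.
have [|f [fP fZ gf fA]] := finite_dim_invariant_frame A_opalg (J_ideal n)
  mu_hom (g := [seq x - p n x | x <- g]) (A_J_fin n).
  by move=> _ /mapP[x _ ->]; have [] := pP n x.
have f_contr x : nrm (frame_op f x) <= nrm x by exact: parseval_contr.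
have [pi pi_hom pi_mu] := mcc_universal B_max
  (compression_alg_hom mu_hom fA)
  (compression_completely_contractive (mcc_isometric B_max) f_contr).
exists (f, pi); split=> // x xg.
(* The frame lies in the kernel, orthogonal to the range, so its projection kills [p n x]. *)
have [Np _ _] := pP n x.
suff fp : frame_op f (p n x) = 0.
  have := gf (x - p n x); rewrite bopB fp subr0; apply.
  by apply/mapP; exists x.
rewrite frame_opE big_seq big1// => y yf.
have yp := ideal_kernel_orthogonal A_opalg (J_ideal n) (e_cai n) mu_hom mu_contr
  mu_adj (fZ y yf) Np.
by rewrite innerC yp rmorph0 scale0r.
Qed.

Section Representations.
Variables (n : nat) (g f : seq K) (pi : bop K -> bop K).
Hypothesis fpiP : adapted n g (f, pi).

Let fP : parseval f. Proof. by case: fpiP. Qed.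
Let pi_star : star_hom B pi. Proof. by case: fpiP. Qed.
Let pi_hom : alg_hom B pi. Proof. by case: pi_star. Qed.

Lemma adapted_adj a c : A a -> adjoint (mu a) c -> pi c = frame_op f * c.
Proof.
move=> Aa ac; have Bm := mu_B Aa.
have := pi_star.2 _ _ Bm (cstar_adj B_cstar Bm ac) ac.
case: fpiP => _ _ -> // _ _ /adjoint_uniq; apply.
by apply: adjointM => //; exact: frame_op_adj.
Qed.

(** The universal property yields operators on all of [K]; this confines them to the span of [f], as
    multiplicativity and faithfulness of [compress f] require. The limit step uses that [pi] is
    contractive. *)
Lemma adapted_corner b : B b ->
  frame_op f * pi b = pi b /\ pi b * frame_op f = pi b.
Proof.
pose P := frame_op f; have PP : P * P = P.
  by apply: bop_ext => x; rewrite bopME /P parseval_idem.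
have [_ _ pi_mu fA _] := fpiP.
have PmP a : A a -> P * (mu a * P) = mu a * P.
  by move=> Aa; apply: bop_ext => x; rewrite !bopME fA.
move: b; apply: (cstar_gen_ind B_cstar (mcc_gen B_max)).
- by rewrite (alg_hom0 B_alg pi_hom) mulr0 mul0r.
- move=> z a b Ba Bb [Pa aP] [Pb bP]; rewrite (alg_homP pi_hom)//.
  rewrite mulrDr mulrDl Pb bP; split; congr (_ + _).
    by apply: bop_ext => x; rewrite bopME !bopZE bopZ -bopME Pa.
  by apply: bop_ext => x; rewrite bopME !bopZE -bopME aP.
- move=> a b Ba Bb [Pa _] [_ bP].
  by rewrite (alg_homM pi_hom)// mulrA Pa -mulrA bP.
- move=> b Bb bl.
  have P1 : opnorm P <= 1.
    by apply: opnorm_le => // x; rewrite mul1r parseval_contr.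
  have small (d : R) b' : B b' -> opnorm (b - b') <= d -> opnorm (pi (b - b')) <= d.
    move=> Bb'; apply: le_trans; apply: (star_hom_contractive B_cstar pi_star).
    exact: opalgB.
  split; apply/eqP; rewrite -subr_eq0; apply/eqP;
    apply: (@nrm_le_eps_eq0 _ _ _ 2) => d d0;
    have [b' [Bb' [Pb' b'P] /(small _ _ Bb')]] := bl d d0;
    set T := pi (b - b') => Td.
  + have -> : P * pi b - pi b = P * T - T.
      by rewrite /T (alg_homB pi_hom)// mulrBr Pb' opprB subrKA.
    rewrite mulrDr mulr1 (le_trans (ler_nrmD _ _))// nrmN lerD//.
    rewrite (le_trans (opnormM _ _))// -[leRHS]mul1r.
    by apply: ler_pM => //; exact: opnorm_ge0.
  + have -> : pi b * P - pi b = T * P - T.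
      by rewrite /T (alg_homB pi_hom)// mulrBl b'P opprB subrKA.
    rewrite mulrDr mulr1 (le_trans (ler_nrmD _ _))// nrmN lerD//.
    rewrite (le_trans (opnormM _ _))// -[leRHS]mulr1.
    by apply: ler_pM => //; exact: opnorm_ge0.
- move=> _ [a Aa <-]; rewrite pi_mu// PmP//; split=> //.
  by rewrite -mulrA PP.
(* The second identity is the adjoint of the invariance relation [PmP]. *)
- move=> _ c [a Aa <-] ac; rewrite (adapted_adj Aa ac); split.
    by rewrite mulrA PP.
  have Padj : adjoint P P by exact: frame_op_adj.
  apply: (@adjoint_uniq _ _ (mu a * P)); last exact: adjointM.
  by rewrite -(PmP a Aa); apply: adjointM => //; exact: adjointM.
Qed.

End Representations.

Variable fpi : forall (n : nat) (g : seq K), seq K * (bop K -> bop K).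
Hypothesis fpiP : forall n g, adapted n g (fpi n g).

(** Tails of the directed set of pairs [(n, g)], ordered by size of [n] and inclusion of the finite
    sets [g]. *)
Definition eventually_index (P : nat -> seq K -> Prop) := exists N (g0 : seq K),
  forall n g, (N <= n)%N -> {subset g0 <= g} -> P n g.

Lemma eventually_indexI P Q : eventually_index P -> eventually_index Q ->
  eventually_index (fun n g => P n g /\ Q n g).
Proof.
move=> [N [g gP]] [M [h hQ]]; exists (maxn N M), (g ++ h) => n k.
rewrite geq_max => /andP[Nn Mn] ghk.
by split; [apply: gP|apply: hQ] => // x xg; apply: ghk; rewrite mem_cat xg ?orbT.
Qed.

Lemma eventually_index_ex P : eventually_index P -> exists n g, P n g.
Proof. by move=> [N [g gP]]; exists N, g; exact: gP. Qed.

Let pi n g := (fpi n g).2.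

Let pi_star n g : star_hom B (pi n g).
Proof. by have := fpiP n g; rewrite /pi; case: (fpi n g) => f q []. Qed.
Let pi_hom n g : alg_hom B (pi n g).
Proof. by case: (pi_star n g). Qed.

(** Strong convergence of [pi n g] to the identity representation. Contractivity of [pi n g],
    uniform in the index, carries it through products and norm limits. *)
Lemma adapted_cvg b : B b -> forall x (d : R), 0 < d ->
  eventually_index (fun n g => nrm (pi n g b x - b x) <= d).
Proof.
move: b; apply: (cstar_gen_ind B_cstar (mcc_gen B_max)).
- move=> x d d0; exists 0%N, [::] => n g _ _.
  by rewrite (alg_hom0 B_alg (pi_hom n g)) subrr nrm0 ltW.
- move=> z a b Ba Bb Ha Hb x d d0; pose M := complex.Re `|z| + 1.
  have M0 : 0 < M by rewrite ltr_wpDl// Re_norm_ge0.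
  have dM : 0 < d / M by rewrite divr_gt0.
  have [N [g0 gP]] := eventually_indexI (Ha x _ dM) (Hb x _ dM).
  exists N, g0 => n g Nn /(gP _ _ Nn)[xa xb].
  rewrite (alg_homP (pi_hom n g))// !bopDE !bopZE opprD addrACA -scalerBr.
  rewrite (le_trans (ler_nrmD _ _))// nrmZ.
  have -> : d = complex.Re `|z| * (d / M) + d / M.
    by rewrite /M; field; rewrite gt_eqF.
  by rewrite lerD// ler_wpM2l// Re_norm_ge0.
- move=> a b Ba Bb Ha Hb x d d0; pose M := opnorm a + 1.
  have M0 : 0 < M by rewrite ltr_wpDl// opnorm_ge0.
  have dM : 0 < d / M by rewrite divr_gt0.
  have [N [g0 gP]] := eventually_indexI (Ha (b x) _ dM) (Hb x _ dM).
  exists N, g0 => n g Nn /(gP _ _ Nn)[xa xb].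
  rewrite (alg_homM (pi_hom n g))// !bopME.
  apply: le_trans (ler_nrm_dist _ (pi n g a (b x)) _) _; rewrite -bopB.
  have -> : d = opnorm a * (d / M) + d / M.
    by rewrite /M; field; rewrite gt_eqF.
  rewrite lerD// (le_trans (nrm_bop_le _ _))//.
  apply: ler_pM; rewrite ?opnorm_ge0 ?nrm_ge0//.
  exact: (star_hom_contractive B_cstar (pi_star n g) Ba).
- move=> b Bb bl x d d0; pose M := 2 * nrm x + 1.
  have M0 : 0 < M by rewrite ltr_wpDl// mulr_ge0 ?nrm_ge0.
  have dM : 0 < d / M by rewrite divr_gt0.
  have [b' [Bb' Hb' bb']] := bl _ dM.
  have [N [g0 gP]] := Hb' x _ dM; exists N, g0 => n g Nn /(gP _ _ Nn) xb'.
  have -> : pi n g b x - b x =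
      pi n g (b - b') x + (pi n g b' x - b' x) + (b' - b) x.
    by rewrite (alg_homB (pi_hom n g))// !bopBE !subrKA.
  have -> : d = d / M * nrm x + d / M + d / M * nrm x.
    by rewrite /M; field; rewrite gt_eqF.
  rewrite (le_trans (ler_nrmD _ _))// lerD//.
    rewrite (le_trans (ler_nrmD _ _))// lerD// (le_trans (nrm_bop_le _ _))//.
    rewrite ler_wpM2r ?nrm_ge0//; apply: le_trans bb'.
    by apply: (star_hom_contractive B_cstar (pi_star n g)); exact: opalgB.
  rewrite (le_trans (nrm_bop_le _ _))// ler_wpM2r ?nrm_ge0//.
  by rewrite -nrm_bopE nrmB.
(* Once [g] contains [x], the error is [mu a (p n x)] up to sign, small for large [n] by
   [range_mu_small]. *)
- move=> _ [a Aa <-] x d d0.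
  have x1 : 0 < nrm x + 1 by rewrite ltr_wpDl ?nrm_ge0.
  have [N NP] := range_mu_small Aa (divr_gt0 d0 x1).
  exists N, [:: x] => n g Nn xg; have := fpiP n g; rewrite /pi.
  case: (fpi n g) => f q /= [_ _ -> // _ gf].
  rewrite bopME gf; last by apply: xg; rewrite mem_head.
  rewrite bopB addrC addKr nrmN; have [Np _ _] := pP n x.
  rewrite (le_trans (NP _ _ Nn Np))//.
  apply: le_trans (ler_wpM2l (ltW (divr_gt0 d0 x1)) (nrm_projection_le n x)) _.
  by rewrite mulrAC ler_pdivrMr// ler_pM2l// lerDl.
(* For the adjoint [c] of [mu a] the test vector is [c x], and the error is [p n (c x)] up to sign.
   Its squared norm pairs [mu a (p n (c x))] with [x], so smallness of [mu a] on the range suffices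
   again. *)
- move=> _ c [a Aa <-] ac x d d0.
  have x1 : 0 < nrm x + 1 by rewrite ltr_wpDl ?nrm_ge0.
  have dx := divr_gt0 d0 x1.
  have [N NP] := range_mu_small Aa dx.
  exists N, [:: c x] => n g Nn xg; rewrite /pi.
  have := fpiP n g; case: (fpi n g) => f q fqP /=.
  rewrite (adapted_adj fqP Aa ac) bopME.
  case: fqP => _ _ _ _ ->; last by apply: xg; rewrite mem_head.
  rewrite addrC addKr nrmN; have [Np _ _] := pP n (c x).
  apply: (@le_trans _ _ (d / (nrm x + 1) * nrm x)); last first.
    by rewrite mulrAC ler_pdivrMr// ler_pM2l// lerDl.
  apply: nrm_rinner_le; first by rewrite mulr_ge0 ?nrm_ge0 ?ltW.
  rewrite nrm_projection_sqr rinnerC /rinner -ac -/(rinner _ _).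
  rewrite (le_trans (rinner_le _ _))// mulrAC ler_wpM2r ?nrm_ge0//.
  exact: (NP _ _ Nn Np).
Qed.

Lemma adapted_separating b : B b -> (forall n g, pi n g b = 0) -> b = 0.
Proof.
move=> Bb b0; apply: bop_ext => x; apply: (@nrm_le_eps_eq0 _ _ _ 1) => d d0.
have [n [g]] := eventually_index_ex (adapted_cvg Bb x d0).
by rewrite b0 sub0r nrmN mulr1.
Qed.

End Projections.

(** The family is indexed by all pairs [(n, g)]. If two elements have equal matrices throughout,
    [adapted_corner] and [compress_eq0] show that every [pi] kills their difference, and
    [adapted_separating] concludes. *)
Lemma ideals_RFD : RFD B.
Proof.
have [p pP] := ideal_projections.
have /choice[fpi fpiP] (i : nat * seq K) : exists fpi, adapted p i.1 i.2 fpi.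
  exact: adapted_ex.
pose f i := (fpi i).1; pose pi i := (fpi i).2.
have fpiE i : adapted p i.1 i.2 (f i, pi i).
  by rewrite /f /pi -surjective_pairing.
have f_parseval i : parseval (f i) by case: (fpiE i).
have pi_star i : star_hom B (pi i) by case: (fpiE i).
have pi_hom i : alg_hom B (pi i) by case: (pi_star i).
exists (nat * seq K)%type, (fun i => size (f i)),
  (fun b i => compress (f i) (pi i b)); split.
- move=> b Bb; exists (opnorm b) => i.
  rewrite (le_trans (mx2norm_compress _ (f_parseval i)))//.
  exact: (star_hom_contractive B_cstar (pi_star i) Bb).
- by move=> z b c i Bb Bc; rewrite (alg_homP (pi_hom i))// compressP.
- move=> b c i Bb Bc; rewrite (alg_homM (pi_hom i))// compressM.
  by rewrite (adapted_corner (fpiE i) Bb).2.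
- by move=> b c i Bb Bc bc; apply: compress_adj; exact: (pi_star i).2.
- move=> b c Bb Bc bc; apply/eqP; rewrite -subr_eq0; apply/eqP.
  have Bbc : B (b - c) by exact: opalgB.
  have fpiP' n g : adapted p n g (fpi (n, g)) by exact: fpiP (n, g).
  apply: (adapted_separating pP fpiP' Bbc) => n g.
  have [fb bf] := adapted_corner (fpiE (n, g)) Bbc.
  rewrite -[LHS]/(pi (n, g) (b - c)); apply: (@compress_eq0 _ _ (f (n, g))).
  + have -> : pi (n, g) (b - c) = (-1) *: pi (n, g) c + pi (n, g) b.
      by rewrite (alg_homB (pi_hom _))// scaleN1r addrC.
    by rewrite compressP bc scaleN1r addNr.
  + by move=> x; rewrite -bopME fb.
  + by move=> x; rewrite -bopME bf.
Qed.

End Approximation.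

Theorem theorem5p5 (R : realType) (H : hilbert R) (A : set (bop H))
  (A_opalg : operator_algebra A)
  (J : nat -> set (bop H)) (J_ideal : forall n : nat, closed_ideal A (J n))
  (Lambda : nat -> directedSet) (e : forall n : nat, Lambda n -> bop H)
  (e_cai : forall n : nat, contractive_approx_id (J n) (e n))
  (lim_ae : forall a : bop H, A a ->
    (fun n : nat => net_liminf (fun l : Lambda n => (opnorm (a * e n l))%:E))
      @ \oo --> 0%E)
  (lim_ea : forall a : bop H, A a ->
    (fun n : nat => net_liminf (fun l : Lambda n => (opnorm (e n l * a))%:E))
      @ \oo --> 0%E)
  (A_J_fin : forall n : nat, finite_dim_quotient A (J n))
  (K : hilbert R) (B : set (bop K)) (mu : bop H -> bop K)
  (B_max : max_cstar_cover A B mu) :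
  RFD B.
Proof. exact: (ideals_RFD B_max A_opalg J_ideal e_cai lim_ae A_J_fin). Qed.
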